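(* For $e=6$ and $n$ large enough, the graph $G^{min}_{n,n-6}$ (a connected graph with minimal spectral radius among all connected graphs on $n$ vertices with diameter $n-6$) is unique up to graph isomorphism, and (1) if $n=2k+12$, then $G^{min}_{n,n-6}=T_{(k,k)}$; (2) if $n=2k+13$, then $G^{min}_{n,n-6}=T_{(k,k+1)}$.
   Context: All graphs are finite and simple. The spectral radius of a graph is the largest eigenvalue of its adjacency matrix; the diameter of a connected graph is the maximum distance between two of its vertices. $G^{min}_{n,D}$ denotes a graph with minimal spectral radius among all connected graphs on $n$ vertices with diameter $D$; equality of graphs means isomorphism. Let $e\ge 6$ and $r=e-4$. For non-negative integers $k_1,\ldots,k_r$, put $n=2e+\sum_{i=1}^r k_i$. The tree $T_{(k_1,\ldots,k_r)}$ is obtained from the path $0\sim 1\sim\cdots\sim (n-e)$ on $n-e+1$ vertices as follows: set $m_1=2$ and $m_{i+1}=m_i+k_i+1$ for $1\le i\le r$ (so $m_{r+1}=n-e-2$); at each of $m_1$ and $m_{r+1}$ attach a pendant path on $2$ vertices (joining one of its end vertices by an edge to $m_1$, resp. $m_{r+1}$), and at each $m_i$ with $2\le i\le r$ attach a single pendant vertex. Here $e=6$, $r=2$. *)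

(* Defs.v *)
From HB Require Import structures.
From mathcomp Require Import all_boot all_order all_algebra.
From mathcomp Require Import boolp classical_sets reals.
From mathcomp Require Import zify.

Set Implicit Arguments.
Unset Strict Implicit.
Unset Printing Implicit Defensive.

Import Order.TTheory GRing.Theory Num.Theory.

Record sgraph := SGraph {
  vertex :> finType;
  adj : rel vertex;
  adj_sym : symmetric adj;
  adj_irr : irreflexive adj
}.

Definition isomorphic (G H : sgraph) : Prop :=
  exists f : G -> H,
    bijective f /\ forall x y : G, adj (f x) (f y) = adj x y.

Definition connected (G : sgraph) : Prop :=
  forall x y : G, connect (@adj G) x y.

Definition has_walk (G : sgraph) (x y : G) (d : nat) : bool :=
  [exists p : d.-tuple G, path (@adj G) x p && (last x p == y)].

(* Least length of a walk from x to y; lengths below #|G| suffice, and the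
   value is #|G| when y is not reachable from x. *)
Definition dist (G : sgraph) (x y : G) : nat :=
  find (has_walk x y) (iota 0 #|G|).

Definition diameter (G : sgraph) : nat :=
  \max_(x : G) \max_(y : G) dist x y.

Section Spectrum.
Local Open Scope ring_scope.

Definition adjmx (R : realType) (G : sgraph) : 'M[R]_#|G| :=
  \matrix_(i, j) (adj (enum_val i) (enum_val j))%:R.

Definition is_largest_eigenvalue (R : realType) (n : nat) (A : 'M[R]_n)
    (rho : R) : Prop :=
  eigenvalue A rho /\ forall mu : R, eigenvalue A mu -> mu <= rho.

(* The default value 0 is only taken by the graph without vertices, every
   other real symmetric matrix having a largest eigenvalue. *)
Definition spectral_radius (R : realType) (G : sgraph) : R :=
  xget 0 [set rho | is_largest_eigenvalue (adjmx R G) rho]%classic.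

Definition in_class (n D : nat) (G : sgraph) : Prop :=
  [/\ #|G| = n, connected G & diameter G = D].

Definition is_Gmin (R : realType) (n D : nat) (G : sgraph) : Prop :=
  in_class n D G /\
  forall H : sgraph, in_class n D H ->
    spectral_radius R G <= spectral_radius R H.

End Spectrum.

(* The tree T_(k_1,...,k_r), for ks = [:: k_1; ...; k_r] and r = size ks > 0,
   where e = r + 4 and n = 2e + k_1 + ... + k_r, so n - e = e + sumn ks. *)
Section Tree.
Variable ks : seq nat.

(* 0-based: branch_pos i is m_(i+1). *)
Fixpoint branch_pos (i : nat) : nat :=
  if i is j.+1 then branch_pos j + nth 0 ks j + 1 else 2.

Definition tree_e : nat := size ks + 4.
Definition tree_n : nat := 2 * tree_e + sumn ks.

(* inl (inl a): vertex a of the path 0 ~ 1 ~ ... ~ n - e;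
   inl (inr i): the vertex attached to m_(i+1);
   inr false, inr true: the far ends of the pendant paths on two vertices
   attached to m_1 and m_(r+1) respectively. *)
Definition tree_vertex : finType :=
  ('I_(tree_n - tree_e).+1 + 'I_(size ks).+1 + bool)%type.

Definition tree_edge (u v : tree_vertex) : bool :=
  match u, v with
  | inl (inl a), inl (inl b) => b == a.+1 :> nat
  | inl (inl a), inl (inr i) => a == branch_pos i :> nat
  | inl (inr i), inr b => i == (if b then ord_max else ord0)
  | _, _ => false
  end.

Definition tree_adj (u v : tree_vertex) : bool :=
  tree_edge u v || tree_edge v u.

Lemma tree_adj_sym : symmetric tree_adj.
Proof. by move=> u v; rewrite /tree_adj orbC. Qed.

Lemma tree_adj_irr : irreflexive tree_adj.
Proof.
move=> [[a|i]|b]; rewrite /tree_adj orbb //=.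
by rewrite ltn_eqF.
Qed.

Definition tree_T : sgraph := SGraph tree_adj_sym tree_adj_irr.

Lemma card_tree_T : #|tree_T| = tree_n.
Proof.
rewrite /tree_T [LHS]card_sum card_sum !card_ord card_bool /tree_n /tree_e.
by move: (size ks) (sumn ks) => r s; lia.
Qed.

Lemma branch_pos_last : branch_pos (size ks) = tree_n - tree_e - 2.
Proof.
have bE i : i <= size ks -> branch_pos i = 2 + i + sumn (take i ks).
  elim: i => [|i IH] lti; first by rewrite take0.
  by rewrite /= (IH (ltnW lti)) (take_nth 0) // sumn_rcons; lia.
rewrite bE // take_size /tree_n /tree_e.
by move: (size ks) (sumn ks) => r s; lia.
Qed.

End Tree.

(* Main.v *)
Require Import Defs.
From HB Require Import structures.
From mathcomp Require Import all_boot all_order all_algebra.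
From mathcomp Require Import boolp classical_sets reals.
From mathcomp Require Import topology normedtype derive.
From mathcomp Require Import zify ring lra.

(* Let T be the tree of the theorem, rho = t + 1/t its spectral radius, s = t^2,
   and let G be a graph of the class with spectral radius at most rho.  The
   Perron vector of G, read along a geodesic v_0, ..., v_D, satisfies
   X_(i-1) + X_(i+1) <= rho X_i, with a defect wherever one of the five vertices
   outside of the geodesic is attached.  Up to this inequality X is a
   combination of t^i and t^(-i); the quantities [fwd] and [bwd] isolate the two
   components.  A single pendant vertex, and an end of the path carrying a pendant
   path of length 2 at its third vertex, are critical when s is the golden ratio,
   that is for rho^2 = 2 + sqrt 5: up to a factor t, the ratio [fwd / bwd] on one
   side of such a vertex is then of order [mu s = s^2 - s - 1].  Every other
   attachment forces a larger rho.  Hence the attachment vertices are far apart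
   and carry a pendant vertex or, near the ends, a pendant path of length 2.
   Between two of them at distance d the ratios multiply to at least s^(-d).

   In T there are four ratios of order mu, so s^(-D) has order mu^4.  With four
   attachment vertices there would be five such ratios over a path of length D,
   which is impossible for large D.  So G has exactly three of them, both ends
   carry a pendant path of length 2, and comparing the middle vertices of G and T
   shows s^e1 + s^e2 <= s^d1 + s^d2 for the gaps, where e1 + e2 = d1 + d2.  Since
   the gaps d1, d2 of T are balanced, G is isomorphic to T. *)

Set Implicit Arguments.
Unset Strict Implicit.
Unset Printing Implicit Defensive.

Import Order.TTheory GRing.Theory Num.Theory.
Import numFieldNormedType.Exports.

(** * Perron vectors *)

Section PerronFrobenius.
Local Open Scope ring_scope.
Variable R : realType.

(** The first-order condition at a maximum, without derivatives. It is applied to the Rayleigh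
    quotient along a coordinate direction. *)
Lemma linear_coef_eq0 (a b : R) : (forall e, e * a <= e ^+ 2 * b) -> a = 0.
Proof.
move=> h; have [b0|b0] := lerP b 0.
  have h1 := h 1; have h2 := h (-1); apply/eqP; rewrite eq_le; apply/andP; split; nra.
(* The maximiser of [e * a - e ^+ 2 * b]. *)
have h1 := h (a / (2 * b)).
have e1 : a / (2 * b) * a = a ^+ 2 / (2 * b) by field; rewrite gt_eqF.
have e2 : (a / (2 * b)) ^+ 2 * b = a ^+ 2 / (2 * b) / 2 by field; rewrite gt_eqF.
move: h1; rewrite e1 e2 => h1.
have : a ^+ 2 / (2 * b) <= 0 by lra.
rewrite ler_pdivrMr; last by rewrite mulr_gt0.
by rewrite mul0r => ha; apply/eqP; rewrite -sqrf_eq0 eq_le ha sqr_ge0.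
Qed.

Definition qform n (A : 'M[R]_n) (x : 'rV[R]_n) : R :=
  \sum_i \sum_j A i j * (x 0 i * x 0 j).

Definition sqnorm n (x : 'rV[R]_n) : R := \sum_i x 0 i ^+ 2.

Lemma sqnorm_ge0 n (x : 'rV[R]_n) : 0 <= sqnorm x.
Proof. by apply: sumr_ge0 => i _; rewrite sqr_ge0. Qed.

Lemma sqnorm_eq0 n (x : 'rV[R]_n) : (sqnorm x == 0) = (x == 0).
Proof.
apply/eqP/eqP => [|->]; last by apply: big1 => i _; rewrite mxE expr0n.
move/eqP; rewrite psumr_eq0; last by move=> i _; rewrite sqr_ge0.
move=> /allP h; apply/rowP => i; rewrite mxE.
by have := h i (mem_index_enum _); rewrite sqrf_eq0 => /eqP.
Qed.

Lemma continuous_qform n (A : 'M[R]_n) : continuous (qform A).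
Proof.
apply: (continuous_big (@add_continuous R)) => i _.
apply: (continuous_big (@add_continuous R)) => j _ x.
have cc k : {for x, continuous (fun v : 'rV[R]_n => v 0 k)}.
  exact: coord_continuous.
exact: (continuousM (@cst_continuous _ _ (A i j) x) (continuousM (cc i) (cc j))).
Qed.

Lemma continuous_sqnorm n : continuous (@sqnorm n).
Proof.
apply: (continuous_big (@add_continuous R)) => i _ x.
have cc : {for x, continuous (fun v : 'rV[R]_n => v 0 i)}.
  exact: coord_continuous.
exact: (continuousM cc cc).
Qed.

Lemma qform_scale n (A : 'M[R]_n) c x : qform A (c *: x) = c ^+ 2 * qform A x.
Proof.
rewrite /qform mulr_sumr; apply: eq_bigr => i _; rewrite mulr_sumr.
by apply: eq_bigr => j _; rewrite !mxE; ring.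
Qed.

Lemma sqnorm_scale n c (x : 'rV[R]_n) : sqnorm (c *: x) = c ^+ 2 * sqnorm x.
Proof.
by rewrite /sqnorm mulr_sumr; apply: eq_bigr => i _; rewrite !mxE; ring.
Qed.

Lemma qform_le_norm n (A : 'M[R]_n) x : (forall i j, 0 <= A i j) ->
  qform A x <= qform A (\row_i `|x 0 i|).
Proof.
move=> A0; apply: ler_sum => i _; apply: ler_sum => j _; rewrite !mxE.
by apply: ler_wpM2l => //; rewrite -normrM ler_norm.
Qed.

Lemma sqnorm_norm n (x : 'rV[R]_n) : sqnorm (\row_i `|x 0 i|) = sqnorm x.
Proof. by apply: eq_bigr => i _; rewrite mxE real_normK ?num_real. Qed.

(** Since the entries of [A] are nonnegative, taking absolute values of the coordinates does not
    decrease the form. So the maximum may be sought among unit vectors in the cube with sides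
    [0, 1], a compact set. *)
Lemma qform_max n (A : 'M[R]_n.+1) : (forall i j, 0 <= A i j) ->
  exists x : 'rV[R]_n.+1, [/\ forall i, 0 <= x 0 i, sqnorm x = 1 &
    forall y, qform A y <= qform A x * sqnorm y].
Proof.
move=> A0.
pose I01 : set R := `[0, 1]%classic.
pose box := [set v : 'rV[R]_n.+1 | forall i, I01 (v ord0 i)]%classic.
pose S := (box `&` (@sqnorm n.+1 @^-1` [set 1]))%classic.
have cS : compact S.
  apply: compact_closedI.
    by apply: (@rV_compact _ _ (fun=> I01)) => i; exact: segment_compact.
  apply: (@preimage_closed _ _ (@sqnorm n.+1) [set 1]%classic) => [v _|].
    exact: continuous_sqnorm.
  exact: closed_eq.
have S0 : (S !=set0)%classic.
  exists (delta_mx 0 0); split=> [i|] /=.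
    by rewrite /I01 /= mxE in_itv /= ler0n lern1 leq_b1.
  rewrite /sqnorm (bigD1 0) //= mxE !eqxx /= expr1n big1 ?addr0 // => i ni.
  by rewrite mxE (negbTE ni) andbF expr0n.
have [x] := EVT_max_rV S0 cS (continuous_subspaceT (@continuous_qform _ A)).
rewrite inE => -[xbox /= x1] xmax; exists x; split => //.
  by move=> i; have := xbox i; rewrite /I01 /= in_itv /= => /andP[].
move=> y; have [->|y0] := eqVneq y 0.
  have e0 k : @sqnorm k 0 = 0 by apply/eqP; rewrite sqnorm_eq0.
  rewrite e0 mulr0 /qform big1 // => i _; rewrite big1 // => j _.
  by rewrite !mxE !mulr0.
apply: le_trans (qform_le_norm _ A0) _; set z := \row_i _.
have Nz : sqnorm z = sqnorm y := sqnorm_norm y.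
have Ny : 0 < sqnorm y by rewrite lt_neqAle eq_sym sqnorm_eq0 y0 sqnorm_ge0.
set c := Num.sqrt (sqnorm y).
have c2 : c ^+ 2 = sqnorm y by rewrite sqr_sqrtr // ltW.
have c0 : 0 < c by rewrite sqrtr_gt0.
have zS : c^-1 *: z \in S.
  have N1 : sqnorm (c^-1 *: z) = 1.
    by rewrite sqnorm_scale exprVn c2 Nz mulVf // gt_eqF.
  rewrite inE; split => [i|//].
  have zi : 0 <= (c^-1 *: z) 0 i by rewrite !mxE mulr_ge0 // invr_ge0 ltW.
  rewrite /I01 /= in_itv /= zi /= -(@ler_pXn2r _ 2) // ?nnegrE // expr1n.
  rewrite -N1 /sqnorm (bigD1 i) //= lerDl.
  by apply: sumr_ge0 => j _; rewrite sqr_ge0.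
have := xmax _ zS; rewrite qform_scale exprVn c2 mulrC ler_pdivrMr //.
Qed.

Lemma perron_nonneg n (A : 'M[R]_n.+1) :
    (forall i j, 0 <= A i j) -> (forall i j, A i j = A j i) ->
  exists (mu : R) (x : 'I_n.+1 -> R), [/\ forall i, 0 <= x i, exists i, x i != 0,
    forall i, \sum_j A i j * x j = mu * x i & is_largest_eigenvalue A mu].
Proof.
move=> A0 As; have [x [x0 x1 xmax]] := qform_max A0.
set mu := qform A x in xmax.
have xn0 : x != 0 by rewrite -sqnorm_eq0 x1 oner_eq0.
have eig i : \sum_j A i j * x 0 j = mu * x 0 i.
  pose a := 2 * (\sum_j A i j * x 0 j - mu * x 0 i).
  suff : a = 0 by rewrite /a; lra.
  (* Maximality tested at [x + e *: delta_mx 0 i] reads [e * a <= e ^+ 2 * (mu - A i i)]. *)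
  apply: (@linear_coef_eq0 _ (mu - A i i)) => e.
  pose y := x + e *: delta_mx 0 i.
  have yE k : y 0 k = x 0 k + e * (k == i)%:R by rewrite !mxE eqxx eq_sym.
  have Ny : sqnorm y = 1 + 2 * e * x 0 i + e ^+ 2.
    transitivity (sqnorm x + 2 * e * x 0 i + e ^+ 2); last by rewrite x1.
    rewrite /sqnorm (bigD1 i) //= [X in _ = X + _ + _](bigD1 i) //= yE eqxx.
    rewrite (eq_bigr (fun k => x 0 k ^+ 2)) => [|k nk] /=; first by ring.
    by rewrite yE (negbTE nk) /=; ring.
  have Qy : qform A y = mu + 2 * e * (\sum_j A i j * x 0 j) + e ^+ 2 * A i i.
    have -> : qform A y = \sum_k \sum_j (A k j * (x 0 k * x 0 j) +
        (e * (A k j * x 0 j) * (k == i)%:R + e * (A k j * x 0 k) * (j == i)%:R +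
         e ^+ 2 * A k j * (k == i)%:R * (j == i)%:R)).
      apply: eq_bigr => k _; apply: eq_bigr => j _; rewrite !yE; ring.
    under eq_bigr do rewrite big_split /= !big_split /=.
    rewrite big_split /= -/(qform A x) -/mu -addrA; congr (_ + _).
    rewrite !big_split /=; congr (_ + _); last first.
      rewrite (bigD1 i) //= (bigD1 i) //= eqxx /= big1 => [|j nj]; last first.
        by rewrite (negbTE nj) mulr0.
      rewrite big1 => [|k nk]; first by rewrite /=; ring.
      by apply: big1 => j _; rewrite (negbTE nk) mulr0 mul0r.
    have -> : \sum_k \sum_j e * (A k j * x 0 j) * (k == i)%:R =
        e * \sum_j A i j * x 0 j.
      rewrite (bigD1 i) //= eqxx /= [X in _ + X]big1 => [|k nk].
        by rewrite addr0 mulr_sumr; apply: eq_bigr => j _; ring.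
      by apply: big1 => j _; rewrite (negbTE nk) mulr0.
    have -> : \sum_k \sum_j e * (A k j * x 0 k) * (j == i)%:R =
        e * \sum_j A i j * x 0 j.
      rewrite mulr_sumr; apply: eq_bigr => k _.
      rewrite (bigD1 i) //= eqxx /= big1 => [|j nj]; last by rewrite (negbTE nj) mulr0.
      by rewrite As; ring.
    by ring.
  have := xmax y; rewrite Ny Qy /a; lra.
exists mu, (x 0); split => //.
  apply/existsP; rewrite -negb_forall; apply: contra xn0 => /forallP h.
  by apply/eqP/rowP => i; rewrite mxE; apply/eqP.
split.
  apply/eigenvalueP; exists x => //; apply/rowP => i; rewrite !mxE -eig.
  by apply: eq_bigr => j _; rewrite As mulrC.
move=> nu /eigenvalueP[y yA y0].
have Ny : 0 < sqnorm y by rewrite lt_neqAle eq_sym sqnorm_eq0 y0 sqnorm_ge0.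
rewrite -(ler_pM2r Ny); apply: le_trans (xmax y).
rewrite /qform exchange_big /= /sqnorm mulr_sumr le_eqVlt; apply/orP; left; apply/eqP.
apply: eq_bigr => j _; move/rowP/(_ j): yA; rewrite !mxE => yA.
have -> : nu * y 0 j ^+ 2 = (nu * y 0 j) * y 0 j by ring.
by rewrite -yA mulr_suml; apply: eq_bigr => i _; ring.
Qed.

Definition nbsum (G : sgraph) (x : G -> R) (v : G) : R := \sum_(u | adj v u) x u.

Lemma spectral_radiusE (G : sgraph) rho :
  is_largest_eigenvalue (adjmx R G) rho -> spectral_radius R G = rho.
Proof.
move=> h; rewrite /spectral_radius; case: xgetP => [y _ /= h'|/(_ rho)//].
by apply/eqP; rewrite eq_le h.2 ?h'.2 //; [exact: h.1|exact: h'.1].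
Qed.

(** Connectedness turns the nonnegative eigenvector into a positive one: a zero entry would spread
    to every vertex. *)
Lemma perron (G : sgraph) : Defs.connected G -> (0 < #|G|)%N -> exists x : G -> R,
  (forall v, 0 < x v) /\ (forall v, nbsum x v = spectral_radius R G * x v).
Proof.
move=> cG; case cardG : #|G| => [//|n] _.
have: exists mu (x : 'I_#|G| -> R), [/\ forall i, 0 <= x i, exists i, x i != 0,
    forall i, \sum_j adjmx R G i j * x j = mu * x i &
    is_largest_eigenvalue (adjmx R G) mu].
  have Ag0 i j : 0 <= adjmx R G i j by rewrite mxE ler0n.
  have Ags i j : adjmx R G i j = adjmx R G j i by rewrite !mxE adj_sym.
  by move: (adjmx R G) Ag0 Ags; rewrite cardG => A; exact: perron_nonneg.
move=> [mu [x [x0 [i0 xi0] eig /spectral_radiusE muE]]].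
pose y (v : G) := x (enum_rank v).
have y0 v : 0 <= y v by exact: x0.
have yE v : nbsum y v = spectral_radius R G * y v.
  rewrite muE /y -eig /nbsum big_mkcond /= (reindex (@enum_val G predT)) /=; last first.
    by apply: onW_bij; exact: enum_val_bij.
  apply: eq_bigr => j _; rewrite mxE enum_rankK enum_valK.
  by case: adj; rewrite ?mul1r ?mul0r.
exists y; split => // v; rewrite lt_neqAle y0 andbT eq_sym.
(* Where the vector vanishes, the nonnegative entries of the neighbours sum to zero, so they vanish
   too. *)
have step a b : adj a b -> y a != 0 -> y b != 0.
  rewrite adj_sym => ab; apply: contra => /eqP yb.
  have := yE b; rewrite yb mulr0 => /eqP.
  rewrite psumr_eq0 // => /allP /(_ a (mem_index_enum _)).
  by rewrite ab.
have /connectP[p pp ->] := cG (enum_val i0) v.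
have : y (enum_val i0) != 0 by rewrite /y enum_valK.
by elim: p (enum_val i0) pp => [//|b p IH] a /= /andP[ab pp] ya; apply: IH pp (step _ _ ab ya).
Qed.

Lemma nbsum_duality (G : sgraph) (x y : G -> R) :
  \sum_v nbsum x v * y v = \sum_v x v * nbsum y v.
Proof.
under eq_bigr do rewrite /nbsum mulr_suml big_mkcond /=.
rewrite exchange_big /=; apply: eq_bigr => v _.
rewrite /nbsum mulr_sumr [RHS]big_mkcond /=; apply: eq_bigr => u _.
by rewrite adj_sym.
Qed.

(** Pairing the two vectors and moving the adjacency operator across gives [a] and [b] times the
    same positive number. Any positive eigenvector thus reveals the spectral radius. *)
Lemma positive_eigenvalue_unique (G : sgraph) (x y : G -> R) (a b : R) (v : G) :
  (forall v, 0 < x v) -> (forall v, 0 < y v) ->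
  (forall v, nbsum x v = a * x v) -> (forall v, nbsum y v = b * y v) -> a = b.
Proof.
move=> x0 y0 xE yE; have := nbsum_duality x y.
under eq_bigr do rewrite xE -mulrA.
under [X in _ = X -> _]eq_bigr do rewrite yE mulrCA.
rewrite -!mulr_sumr => /mulIf; apply; rewrite gt_eqF //.
rewrite (bigD1 v) //= ltr_wpDr ?mulr_gt0 //.
by apply: sumr_ge0 => u _; rewrite ltW ?mulr_gt0.
Qed.

Lemma isomorphic_sym (G H : sgraph) : isomorphic G H -> isomorphic H G.
Proof.
move=> [f [[g fK gK] fadj]]; exists g; split; first by exists f.
by move=> x y; rewrite -fadj !gK.
Qed.

Lemma isomorphic_connected (G H : sgraph) :
  isomorphic G H -> Defs.connected G -> Defs.connected H.
Proof.
move=> [f [[g fK gK] fadj]] cG x y; rewrite -(gK x) -(gK y).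
have /connectP[p pp ->] := cG (g x) (g y).
apply/connectP; exists (map f p); last by rewrite last_map.
by rewrite path_map; apply: sub_path pp => a b; rewrite /= fadj.
Qed.

Lemma isomorphic_card (G H : sgraph) : isomorphic G H -> #|G| = #|H|.
Proof. by move=> [f [bf _]]; exact: bij_eq_card bf. Qed.

Lemma isomorphic_spectral_radius (G H : sgraph) :
  Defs.connected G -> (0 < #|G|)%N -> isomorphic G H ->
  spectral_radius R G = spectral_radius R H.
Proof.
move=> cG G0 iGH; have cH := isomorphic_connected iGH cG.
have H0 : (0 < #|H|)%N by rewrite -(isomorphic_card iGH).
have [x [x0 xE]] := perron cG G0; have [y [y0 yE]] := perron cH H0.
have /card_gt0P[v _] := G0.
case: iGH => f [bf fadj].
apply: (@positive_eigenvalue_unique G x (y \o f) _ _ v) => // u; first exact: y0.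
rewrite /= -yE /nbsum (reindex f) /=; last exact: onW_bij.
by apply: eq_bigl => w; rewrite fadj.
Qed.

End PerronFrobenius.

(** * Walks and geodesics *)

Section Walks.
Implicit Type G H : sgraph.

Lemma has_walkP G (x y : G) l :
  reflect (exists p, [/\ path (@adj G) x p, last x p = y & size p = l])
    (has_walk x y l).
Proof.
apply: (iffP existsP) => [[p /andP[pp /eqP lp]]|[p [pp lp sp]]].
  by exists p; rewrite size_tuple.
have st : size p == l by apply/eqP.
by exists (Tuple st); rewrite /= pp lp eqxx.
Qed.

Lemma has_walk0 G (x : G) : has_walk x x 0.
Proof. by apply/has_walkP; exists [::]. Qed.

Lemma has_walk1 G (x y : G) : adj x y -> has_walk x y 1.
Proof. by move=> xy; apply/has_walkP; exists [:: y]; rewrite /= xy. Qed.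

Lemma has_walk_cat G (x y z : G) a b :
  has_walk x y a -> has_walk y z b -> has_walk x z (a + b).
Proof.
move=> /has_walkP[p [pp lp <-]] /has_walkP[q [pq lq <-]].
apply/has_walkP; exists (p ++ q).
by rewrite cat_path last_cat lp size_cat pp pq.
Qed.

Lemma has_walk_sym G (x y : G) l : has_walk x y l -> has_walk y x l.
Proof.
move=> /has_walkP[p [pp <- <-]]; apply/has_walkP.
exists (rev (belast x p)); rewrite size_rev size_belast.
rewrite rev_path (eq_path (e' := @adj G)) => [|a b]; last by rewrite adj_sym.
rewrite pp; split=> //; case: p {pp} => //= a p.
by rewrite rev_cons last_rcons.
Qed.

Lemma has_walk_connect G (x y : G) l : has_walk x y l -> connect (@adj G) x y.
Proof. by move=> /has_walkP[p [pp <- _]]; apply/connectP; exists p. Qed.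

Lemma has_walk_map G H (f : G -> H) (x y : G) l :
  (forall a b, adj a b -> adj (f a) (f b)) ->
  has_walk x y l -> has_walk (f x) (f y) l.
Proof.
move=> fadj /has_walkP[p [pp <- <-]]; apply/has_walkP; exists (map f p).
rewrite last_map size_map path_map; split => //.
exact: sub_path pp.
Qed.

(** Provides lower bounds on distances: in the tree, [g] will be the projection to the path. *)
Lemma has_walk_lipschitz G (g : G -> nat) (x y : G) l :
  (forall a b, adj a b -> g b <= g a + 1) -> has_walk x y l -> g y <= g x + l.
Proof.
move=> g1 /has_walkP[p [pp <- <-]]; elim: p x pp => [|a p IH] x /=; first by lia.
by move=> /andP[/g1 xa /IH]; lia.
Qed.

Lemma has_walk_shorten G (x y : G) l : has_walk x y l ->
  exists p, [/\ path (@adj G) x p, last x p = y, uniq (x :: p) & size p <= l].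
Proof.
move=> /has_walkP[p [pp <- <-]]; case/shortenP: pp => q pq uq sq.
by exists q; split=> //; move: uq => /= /andP[_ uq]; exact: uniq_leq_size.
Qed.

Lemma distP G (x y : G) : connect (@adj G) x y ->
  has_walk x y (dist x y) /\ forall l, has_walk x y l -> dist x y <= l.
Proof.
move=> /connectP[p0 pp0 lp0].
have w0 : has_walk x y (size p0) by apply/has_walkP; exists p0.
have [q [pq lq uq _]] := has_walk_shorten w0.
have hs : has (has_walk x y) (iota 0 #|G|).
  apply/hasP; exists (size q); last by apply/has_walkP; exists q.
  by rewrite mem_iota /= add0n -[(size q).+1]/(size (x :: q)) -(card_uniqP uq) max_card.
have lt : dist x y < #|G| by rewrite -[X in _ < X](size_iota 0) -has_find.
split; first by have := nth_find 0 hs; rewrite nth_iota.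
move=> l wl; have [//|ltl] := leqP (dist x y) l.
have := before_find 0 ltl; rewrite nth_iota ?add0n ?wl //.
exact: ltn_trans lt.
Qed.

(** Removes [dist] from the later arguments, which only handle walks. *)
Lemma diameterP G D : Defs.connected G -> 0 < #|G| ->
  diameter G = D <->
  (exists x y : G, forall l, has_walk x y l -> D <= l) /\
  (forall x y : G, exists2 l, l <= D & has_walk x y l).
Proof.
move=> cG G0; split=> [<-|[[x [y xy]] all]].
  split=> [|x y]; last first.
    exists (dist x y); last by have [] := distP (cG x y).
    rewrite /diameter; apply: leq_trans (leq_bigmax x).
    exact: (leq_bigmax (F := fun y => dist x y)).
  rewrite /diameter.
  have [x ->] := bigop.eq_bigmax (fun x : G => \max_(y : G) dist x y) G0.
  have [y ->] := bigop.eq_bigmax (fun y : G => dist x y) G0.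
  by exists x, y; have [] := distP (cG x y).
apply/eqP; rewrite eqn_leq; apply/andP; split.
  apply/bigmax_leqP => a _; apply/bigmax_leqP => b _.
  have [l lD wl] := all a b; apply: leq_trans lD.
  by have [_] := distP (cG a b); exact.
apply: leq_trans (leq_bigmax x).
apply: leq_trans (leq_bigmax (F := fun y => dist x y) y).
by apply: xy; have [] := distP (cG x y).
Qed.

Lemma isomorphic_in_class n D G H :
  0 < n -> isomorphic G H -> in_class n D G -> in_class n D H.
Proof.
move=> n0 iGH [cardG cG dG].
have cardH : #|H| = n by rewrite -(isomorphic_card iGH).
have cH := isomorphic_connected iGH cG.
split=> //; apply/diameterP => //; first by rewrite cardH.
move/diameterP: dG => []//; first by rewrite cardG.
move=> [x [y xy]] all; case: iGH => f [[g fK gK] fadj].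
have gadj a b : adj (g a) (g b) = adj a b by rewrite -fadj !gK.
split.
  exists (f x), (f y) => l w; apply: xy; rewrite -(fK x) -(fK y).
  by apply: has_walk_map w => a b; rewrite gadj.
move=> a b; have [l lD w] := all (g a) (g b); exists l => //.
rewrite -(gK a) -(gK b).
by apply: has_walk_map w => c d; rewrite fadj.
Qed.

(** Minimality is demanded for the two ends only; [geodesic_dist] extends it to all pairs. Values of
    [v] beyond [D] are irrelevant. *)
Definition geodesic G D (v : nat -> G) :=
  (forall i, i < D -> adj (v i) (v i.+1)) /\
  (forall l, has_walk (v 0) (v D) l -> D <= l).

Lemma geodesic_walk G D (v : nat -> G) i j :
  geodesic D v -> i <= j -> j <= D -> has_walk (v i) (v j) (j - i).
Proof.
move=> [vadj _] ij jD; elim: j ij jD => [|j IH] ij jD.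
  by move: ij; rewrite leqn0 => /eqP ->; rewrite subnn has_walk0.
have [->|lt] : i = j.+1 \/ i <= j by lia.
  by rewrite subnn has_walk0.
have -> : j.+1 - i = j - i + 1 by lia.
by apply: has_walk_cat (IH lt (ltnW jD)) _; apply: has_walk1; exact: vadj.
Qed.

(** A shortcut between [v i] and [v j] would shorten the walk from [v 0] to [v D]. *)
Lemma geodesic_dist G D (v : nat -> G) i j l :
  geodesic D v -> i <= j -> j <= D -> has_walk (v i) (v j) l -> j - i <= l.
Proof.
move=> gv ij jD w.
have w1 := geodesic_walk gv (leq0n i) (leq_trans ij jD).
have w2 := geodesic_walk gv jD (leqnn D).
have := gv.2 _ (has_walk_cat (has_walk_cat w1 w) w2); lia.
Qed.

Lemma geodesic_inj G D (v : nat -> G) i j :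
  geodesic D v -> i <= D -> j <= D -> v i = v j -> i = j.
Proof.
move=> gv; wlog ij : i j / i <= j => [h|] iD jD vij.
  by have [ij|/ltnW ji] := leqP i j; [exact: h|apply/esym/h].
have := geodesic_dist gv ij jD; rewrite vij => /(_ _ (has_walk0 _)); lia.
Qed.

Lemma geodesic_adj G D (v : nat -> G) i j : geodesic D v -> i <= D -> j <= D ->
  adj (v i) (v j) = (i == j.+1) || (j == i.+1).
Proof.
move=> gv iD jD; apply/idP/idP => [vij|/orP[]/eqP e].
- have [ij|ji] := leqP i j.
    have := geodesic_dist gv ij jD (has_walk1 vij) => h.
    suff : i != j by lia.
    by apply/eqP => e; move: vij; rewrite e adj_irr.
  rewrite adj_sym in vij.
  have := geodesic_dist gv (ltnW ji) iD (has_walk1 vij); lia.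
- by subst i; rewrite adj_sym; apply: gv.1.
- by subst j; apply: gv.1.
Qed.

Lemma geodesic_rev G D (v : nat -> G) :
  geodesic D v -> geodesic D (fun i => v (D - i)).
Proof.
move=> gv; split=> [i iD|l].
  by rewrite (geodesic_adj gv) ?leq_subr //; lia.
by rewrite subn0 subnn => /has_walk_sym; exact: gv.2.
Qed.

Lemma diameter_geodesic G D : Defs.connected G -> 0 < #|G| -> diameter G = D ->
  exists v : nat -> G, geodesic D v.
Proof.
move=> cG G0 /diameterP[]// [x [y xy]] all.
have [l lD /has_walkP[p [pp lp sp]]] := all x y.
have eD : D = size p.
  apply/eqP; rewrite eqn_leq xy ?sp //.
  by apply/has_walkP; exists p.
exists (nth x (x :: p)); split=> [i iD|k].
  by move/(pathP x): pp; apply; rewrite -eD.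
by rewrite /= eD -last_nth lp -eD; apply: xy.
Qed.

End Walks.

(** * Supersolutions of the path recurrence *)

Ltac lia_without R := repeat match goal with H : ?T |- _ =>
  match T with context [R] => clear H end end; lia.

Section Powers.
Local Open Scope ring_scope.
Variables (R : realFieldType) (s : R).

Lemma exprn_ge_mono (a : R) n m : 1 <= a -> a <= s -> (n <= m)%N -> a ^+ n <= s ^+ m.
Proof.
move=> a1 as_ nm; apply: (@le_trans _ _ (s ^+ n)).
  by rewrite lerXn2r ?nnegrE //; lra.
by rewrite ler_weXn2l //; lra.
Qed.

Lemma exprn_le_mono (a : R) n m : 1 <= s -> s <= a -> (m <= n)%N -> s ^+ m <= a ^+ n.
Proof.
move=> s1 sa mn; apply: (@le_trans _ _ (s ^+ n)).
  by rewrite ler_weXn2l.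
by rewrite lerXn2r ?nnegrE //; lra.
Qed.

(** The numbers 8/5 and 33/20 enclose [s] as soon as it is close enough to the golden ratio. The
    three numerical bounds serve to exclude overloaded vertices and to separate attachment
    vertices. *)
Lemma exprn_ge20 n : 8 / 5 <= s -> (9 <= n)%N -> 20 <= s ^+ n.
Proof.
move=> s8 n9; apply: le_trans (exprn_ge_mono _ s8 n9); lra.
Qed.

Lemma exprn_ge7000 n : 8 / 5 <= s -> (19 <= n)%N -> 7000 <= s ^+ n.
Proof. by move=> s8 n19; apply: le_trans (exprn_ge_mono _ s8 n19); lra. Qed.

Lemma exprn_le91 n : 1 <= s -> s <= 33 / 20 -> (n <= 9)%N -> s ^+ n <= 91.
Proof. by move=> s1 s33 n9; apply: le_trans (exprn_le_mono s1 s33 n9) _; lra. Qed.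

End Powers.

Section Supersolutions.
Local Open Scope ring_scope.
Variable R : realFieldType.
Implicit Types (t s k a b c : R) (X : nat -> R) (M i j : nat).

(* A vertex of the path whose neighbours outside of the path have total weight at
   least [k / t] times its own. *)
Definition load t k X i := t * X i.-1 + t * X i.+1 + k * X i <= (t * t + 1) * X i.

(* The vertices of the path are indexed from [1] to [M]. *)
Definition supersolution t M X :=
  [/\ X 0%N = 0, X M.+1 = 0, forall i, (0 < i <= M)%N -> 0 < X i &
      forall i, (0 < i <= M)%N -> load t 0 X i].

(* [fwd] vanishes on [t ^- i] and [bwd] on [t ^+ i]. *)
Definition fwd t X i := t * X i.+1 - X i.
Definition bwd t X i := t * X i.-1 - X i.

(** Reversing the path fixes the boundary conditions and exchanges [fwd] and [bwd], so every
    one-sided estimate has a counterpart for the other side. *)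
Definition mirror M X i := X (M.+1 - i)%N.

Lemma load_mirror t k M X i : (0 < i <= M)%N ->
  load t k X i -> load t k (mirror M X) (M.+1 - i)%N.
Proof.
move=> iM; rewrite /load /mirror.
have -> : (M.+1 - (M.+1 - i) = i)%N by lia.
have -> : (M.+1 - (M.+1 - i).-1 = i.+1)%N by lia.
have -> : (M.+1 - (M.+1 - i).+1 = i.-1)%N by lia.
by rewrite [t * X i.+1 + _]addrC.
Qed.

Lemma supersolution_mirror t M X :
  supersolution t M X -> supersolution t M (mirror M X).
Proof.
move=> [X0 XM Xp Xl]; split; rewrite /mirror ?subn0 ?subnn // => i iM.
  by apply: Xp; lia.
have -> : i = (M.+1 - (M.+1 - i))%N by lia.
by apply: load_mirror; [lia|apply: Xl; lia].
Qed.

Lemma fwd_mirror t M X i : (0 < i <= M.+1)%N ->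
  fwd t (mirror M X) (M.+1 - i) = bwd t X i.
Proof.
move=> iM; rewrite /fwd /bwd /mirror.
by have [-> ->] : (M.+1 - (M.+1 - i).+1 = i.-1 /\ M.+1 - (M.+1 - i) = i)%N by lia.
Qed.

Lemma bwd_mirror t M X i : (i <= M)%N ->
  bwd t (mirror M X) (M.+1 - i) = fwd t X i.
Proof.
move=> iM; rewrite /fwd /bwd /mirror.
by have [-> ->] : (M.+1 - (M.+1 - i).-1 = i.+1 /\ M.+1 - (M.+1 - i) = i)%N by lia.
Qed.

Variables (t s : R) (M : nat) (X : nat -> R).
Hypotheses (t1 : 1 < t) (tts : t * t = s) (Xs : supersolution t M X).

Let s1 : 1 < s. Proof. by move: (t1) => h; rewrite -tts; nra. Qed.
Ltac nlia := lia_without R.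
Ltac facts := move: (t1) (tts) (s1) => ? ? ?.

Lemma loadE k i :
  load t k X i <-> t * X i.-1 + t * X i.+1 + k * X i <= (s + 1) * X i.
Proof. by rewrite /load tts. Qed.

(** With the next identity, this eliminates [X i] in favour of the two components on an adjacent
    edge. *)
Lemma fwd_bwd_succ i : fwd t X i + t * bwd t X i.+1 = (s - 1) * X i.
Proof. by rewrite /fwd /bwd /= -tts; ring. Qed.

Lemma bwd_fwd_pred i : (0 < i)%N -> bwd t X i + t * fwd t X i.-1 = (s - 1) * X i.
Proof. by move=> i0; rewrite /fwd /bwd prednK // -tts; ring. Qed.

Lemma load_fwd_bwd k i : load t k X i -> fwd t X i + bwd t X i <= (s - 1 - k) * X i.
Proof. by move=> /loadE; rewrite /fwd /bwd; lra. Qed.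

(** This is the path inequality itself: to the right [fwd] grows by a factor of at most [t] per
    step, and to the left [bwd] does. Without a defect both are equalities. *)
Lemma fwd_step i : (0 < i <= M)%N -> fwd t X i <= t * fwd t X i.-1.
Proof.
facts.
move=> iM; have /loadE := let: And4 _ _ _ h := Xs in h i iM.
have i0 : (0 < i)%N by nlia.
by rewrite /fwd prednK // -tts; nra.
Qed.

Lemma bwd_step i : (0 < i <= M)%N -> bwd t X i <= t * bwd t X i.+1.
Proof.
facts.
by move=> iM; have /loadE := let: And4 _ _ _ h := Xs in h i iM; rewrite /bwd /= -tts; nra.
Qed.

Lemma fwd_le i d : (i + d <= M)%N -> fwd t X (i + d) <= t ^+ d * fwd t X i.
Proof.
facts.
elim: d => [|d IH] iM; first by rewrite addn0 expr0 mul1r.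
have h : (0 < i + d.+1 <= M)%N by nlia.
apply: le_trans (fwd_step h) _; rewrite addnS /= exprS -mulrA.
by rewrite ler_pM2l; [apply: IH; nlia|lra].
Qed.

Lemma bwd_le i d : (0 < i)%N -> (i + d <= M.+1)%N ->
  bwd t X i <= t ^+ d * bwd t X (i + d).
Proof.
facts.
move=> i0; elim: d => [|d IH] iM; first by rewrite addn0 expr0 mul1r.
apply: le_trans (IH _) _; first by nlia.
rewrite addnS exprSr -mulrA ler_pM2l; last by rewrite exprn_gt0; lra.
by apply: bwd_step; nlia.
Qed.

Let Xp i : (0 < i <= M)%N -> 0 < X i. Proof. by case: Xs => _ _ h _; exact: h. Qed.

(* A negative [fwd t X i] makes [t ^+ (j - i) * X j] decrease by at least
   [- s ^+ (j - i) * fwd t X i] at each step [j]. *)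
Lemma fwd_tail i : (0 < i < M)%N -> - fwd t X i * s ^+ (M - 1 - i) < X i.
Proof.
facts.
move=> iM; have Xi : 0 < X i by apply: Xp; nlia.
have [f0|f0] := lerP 0 (fwd t X i).
  apply: le_lt_trans Xi; rewrite mulNr oppr_le0 mulr_ge0 // exprn_ge0 //; lra.
have step d : (i + d <= M)%N ->
    t ^+ d.+1 * X (i + d).+1 - t ^+ d * X (i + d) <= s ^+ d * fwd t X i.
  move=> dM; have -> : t ^+ d.+1 * X (i + d).+1 - t ^+ d * X (i + d) = t ^+ d * fwd t X (i + d).
    by rewrite /fwd exprS; ring.
  rewrite -tts exprMn -mulrA ler_pM2l ?fwd_le // exprn_gt0; lra.
have dec d : (i + d <= M)%N -> t ^+ d * X (i + d) <= X i.
  elim: d => [|d IH] dM; first by rewrite addn0 expr0 mul1r.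
  have := step d (ltac:(nlia)); have := IH (ltac:(nlia)).
  have : s ^+ d * fwd t X i <= 0 by rewrite pmulr_rle0 ?exprn_gt0 ?ltW //; lra.
  by rewrite addnS; lra.
have e : (i + (M - 1 - i) = M - 1)%N by nlia.
have := step (M - 1 - i)%N (ltac:(nlia)); have := dec (M - 1 - i)%N (ltac:(nlia)).
rewrite e; have -> : (M - 1).+1 = M by nlia.
have : 0 < t ^+ (M - 1 - i).+1 * X M.
  by apply: mulr_gt0; [apply: exprn_gt0; lra|apply: Xp; nlia].
lra.
Qed.

(* [kappa1], [kappa2], [kappa3] are the values of [t * X d / X d.+1], d = 1, 2, 3,
   for the solution on a path without attachments; they are also the loads of
   pendant paths on 1, 2, 3 vertices. *)
Definition kappa1 := s / (s + 1).
Definition kappa2 := s * (s + 1) / (s ^+ 2 + s + 1).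
Definition kappa3 := s * (s ^+ 2 + s + 1) / (s ^+ 3 + s ^+ 2 + s + 1).

(** Each coefficient arises from the previous one by [a] to [s / (s + 1 - a)], the step made in
    [ratio_step] along the path and in [weight_step] outside of it. *)
Lemma kappa2E : kappa2 = s / (s + 1 - kappa1).
Proof. facts; rewrite /kappa2 /kappa1; field; rewrite !gt_eqF //; nra. Qed.

Lemma kappa3E : kappa3 = s / (s + 1 - kappa2).
Proof. facts; rewrite /kappa3 /kappa2; field; rewrite !gt_eqF //; nra. Qed.

Lemma kappa_lt : [/\ 0 < kappa1, kappa1 < s & kappa2 < s].
Proof.
facts.
rewrite /kappa1 /kappa2 divr_gt0 ?ltr_pdivrMr; try nra.
by split=> //; nra.
Qed.

Lemma kappa2_le : kappa2 <= kappa3.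
Proof.
facts; rewrite /kappa2 /kappa3.
have q2 : 0 < s ^+ 2 + s + 1 by nra.
have q3 : 0 < s ^+ 3 + s ^+ 2 + s + 1 by rewrite !addr_gt0 ?exprn_gt0 //; lra.
rewrite ler_pdivrMr // mulrAC ler_pdivlMr // -subr_ge0.
have -> : s * (s ^+ 2 + s + 1) * (s ^+ 2 + s + 1) -
    s * (s + 1) * (s ^+ 3 + s ^+ 2 + s + 1) = s ^+ 3.
  by ring.
by rewrite exprn_ge0 //; lra.
Qed.

Lemma ratio_step a i : (0 < i < M)%N -> a < s + 1 ->
  a * X i <= t * X i.-1 -> s / (s + 1 - a) * X i.+1 <= t * X i.
Proof.
facts.
move=> iM a1 h; have /loadE := let: And4 _ _ _ h := Xs in h i (ltac:(nlia)).
rewrite mulrAC ler_pdivrMr; last lra.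
rewrite -tts; nra.
Qed.

Lemma ratio1 i : (1 < i <= M)%N -> kappa1 * X i <= t * X i.-1.
Proof.
facts.
case: i => [//|[//|i]] iM; rewrite /kappa1 -[s + 1]subr0.
apply: ratio_step; [nlia|lra|rewrite mul0r mulr_ge0 //; first lra].
case: i iM => [|i] iM; last by apply/ltW/Xp; nlia.
by case: Xs => -> _ _ _.
Qed.

Lemma ratio2 i : (2 < i <= M)%N -> kappa2 * X i <= t * X i.-1.
Proof.
facts.
case: i => [//|i] iM; have [_ k1 _] := kappa_lt; rewrite kappa2E.
by apply: ratio_step; [nlia|lra|apply: ratio1; nlia].
Qed.

Lemma ratio3 i : (3 < i <= M)%N -> kappa3 * X i <= t * X i.-1.
Proof.
facts.
case: i => [//|i] iM; have [_ _ k2] := kappa_lt; rewrite kappa3E.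
by apply: ratio_step; [nlia|lra|apply: ratio2; nlia].
Qed.

(** A crude ratio that assumes nothing about signs: with [ratio1] on the left, [fwd] is at most
    [(s - 2 * kappa1) * X i], which equals [kappa1 * (fwd + t * bwd)]. Solving for [fwd] gives the
    factor [s]. *)
Lemma hot_fwd_le i : (1 < i <= M)%N -> load t kappa1 X i ->
  0 < bwd t X i.+1 /\ fwd t X i <= s * (t * bwd t X i.+1).
Proof.
facts.
move=> iM /loadE hi; have r := ratio1 iM; have e := fwd_bwd_succ i.
have Xi : 0 < X i by apply: Xp; nlia.
have U : fwd t X i <= (s - 2 * kappa1) * X i by rewrite /fwd; lra.
have k : (s - 2 * kappa1) = s / (s + 1) * (s - 1).
  by rewrite /kappa1; field; rewrite !gt_eqF //; lra.
rewrite k -mulrA -e in U.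
have U' : fwd t X i <= s * (t * bwd t X i.+1).
  move: U; rewrite mulrAC ler_pdivlMr; last by lra.
  by move=> h; lra.
split=> //; rewrite -(pmulr_rgt0 _ (_ : 0 < t)) //; last by lra.
have := mulr_gt0 (ltac:(lra) : 0 < s - 1) Xi; rewrite -e; nra.
Qed.

(** Going once around the gap: [fwd] travels from [i] to [j], is turned into [bwd] by [c'], travels
    back and is turned into [fwd] by [c]. The travel contributes at most [s ^+ (j - i)], and a
    positive quantity cannot return smaller than itself. *)
Lemma gap_bound c c' i j : (0 < i < j)%N -> (j <= M)%N -> 0 <= c -> 0 <= c' ->
  0 < bwd t X i.+1 -> 0 < fwd t X j.-1 ->
  fwd t X i <= c * (t * bwd t X i.+1) -> bwd t X j <= c' * (t * fwd t X j.-1) ->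
  1 <= s ^+ (j - i) * (c * c').
Proof.
facts.
move=> ij jM c0 c'0 Vi Uj hi hj.
have [d dE] : exists d, (j = i + d.+1)%N by exists (j - i.+1)%N; nlia.
subst j; rewrite addnS /= in Uj hj *.
have -> : ((i + d).+1 - i = d.+1)%N by nlia.
have h1 := fwd_le (ltac:(nlia) : (i + d <= M)%N).
have h2 := bwd_le (ltn0Sn i) (ltac:(nlia) : (i.+1 + d <= M.+1)%N).
rewrite addSn in h2.
set Vi1 := bwd t X i.+1 in Vi hi h2; set Uj1 := fwd t X (i + d) in Uj hj h1.
have td : 0 < t ^+ d by rewrite exprn_gt0 //; lra.
have h1' : Uj1 <= t ^+ d * (c * (t * Vi1)).
  by apply: le_trans h1 _; rewrite ler_pM2l.
have h2' : Vi1 <= t ^+ d * (c' * (t * Uj1)).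
  by apply: le_trans h2 _; rewrite ler_pM2l.
have := ler_pM (ltW Uj) (ltW Vi) h1' h2'.
have -> : t ^+ d * (c * (t * Vi1)) * (t ^+ d * (c' * (t * Uj1))) =
    s ^+ d.+1 * (c * c') * (Uj1 * Vi1).
  by rewrite -tts exprMn !exprS; ring.
by rewrite -{1}[Uj1 * Vi1]mul1r ler_pM2r // mulr_gt0.
Qed.

(* Zero exactly for the golden ratio, i.e. for [t + 1 / t] equal to the square root
   of [2 + sqrt 5]. *)
Definition mu := s ^+ 2 - s - 1.

Hypothesis mu_bounds : 0 < mu <= 1 / 1000.

Let s_bounds : 8 / 5 < s /\ s < 33 / 20.
Proof. by facts; move: mu_bounds; rewrite /mu => /andP[]; split; nra. Qed.
Ltac facts_mu := facts; move: (mu_bounds) (s_bounds) => /andP[m0 m1] [s8 s33];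
  have muE : mu = s ^+ 2 - s - 1 by [].

(** The origin of [mu]: with one pendant vertex, [fwd + bwd] is at most [mu / (s + 1)] times the
    value there. *)
Lemma hot_load k : kappa1 <= k -> s - 1 - k <= mu / (s + 1).
Proof.
facts_mu.
move=> k1; have -> : mu / (s + 1) = s - 1 - kappa1.
  by rewrite /mu /kappa1; field; rewrite !gt_eqF //; lra.
lra.
Qed.

(** Dropping the nonnegative [fwd] bounds [bwd] by [mu / (s + 1) * X j]. Expressing [X j] by [bwd]
    and the incoming [fwd], and using [s ^+ 2 - 1 - mu = s], gives the small ratio. *)
Lemma interior_bwd_le j : (0 < j <= M)%N -> load t kappa1 X j -> 0 <= fwd t X j ->
  bwd t X j <= mu / s * (t * fwd t X j.-1).
Proof.
facts_mu.
move=> jM /load_fwd_bwd h U0; have e := bwd_fwd_pred (ltac:(nlia) : (0 < j)%N).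
have Xj : 0 < X j by apply: Xp; nlia.
have h1 : bwd t X j <= mu / (s + 1) * X j.
  have := ler_wpM2r (ltW Xj) (hot_load (lexx kappa1)); lra.
have e' : X j = (bwd t X j + t * fwd t X j.-1) / (s - 1).
  by rewrite e; field; rewrite !gt_eqF //; lra.
move: h1; rewrite e'; set B := bwd t X j; set F := t * _.
have -> : mu / (s + 1) * ((B + F) / (s - 1)) = mu * (B + F) / (s ^+ 2 - 1).
  by field; rewrite !gt_eqF //; nra.
rewrite ler_pdivlMr; last by nra.
by move=> h1; rewrite mulrAC ler_pdivlMr; [move: h1; rewrite /mu; lra|lra].
Qed.

(** The two contributions force [fwd] at [i] below [- X i / 20]. With at least nine more steps to
    the right, [s ^+ 9 >= 20] then contradicts [fwd_tail]. *)
Lemma overload a k i : (0 < i)%N -> (i + 10 <= M)%N -> a * X i <= t * X i.-1 ->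
  load t k X i -> s + 1 / 20 <= a + k -> False.
Proof.
move=> i0 iM ha /loadE hk ak; have Xi : 0 < X i by apply: Xp; nlia.
have U : fwd t X i <= - (1 / 20) * X i.
  have := ler_wpM2r (ltW Xi) ak; rewrite /fwd; lra.
have := fwd_tail (ltac:(nlia) : (0 < i < M)%N).
have := exprn_ge20 (ltW s_bounds.1) (ltac:(nlia) : (9 <= M - 1 - i)%N).
move: ha hk ak => _ _ _; nra.
Qed.

(** The forbidden attachments, near the golden ratio: two pendant vertices at one vertex; a pendant
    path of length 2 beyond the third vertex, or one of length 3 at it; a fork whose root is
    attached to the path. *)
Lemma overload_numerics :
  [/\ s + 1 / 20 <= kappa1 + 2 * kappa1, s + 1 / 20 <= kappa3 + kappa2 &
      s + 1 / 20 <= kappa1 + s / (s + 1 - 2 * kappa1)].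
Proof.
facts_mu.
have k1 : 61 / 100 <= kappa1 by rewrite /kappa1 ler_pdivlMr; lra.
have k2 : 80 / 100 <= kappa2 by rewrite /kappa2 ler_pdivlMr; nra.
have s2 : s ^+ 2 <= s + 1 + 1 / 1000 by lra.
have s20 : s + 1 <= s ^+ 2 by lra.
have s162 : s <= 162 / 100 by nra.
have s3 : s ^+ 3 <= s ^+ 2 * (162 / 100) by rewrite exprSr ler_wpM2l //; nra.
have k3 : 88 / 100 <= kappa3.
  rewrite /kappa3 ler_pdivlMr; last by rewrite !addr_gt0 ?exprn_gt0 //; lra.
  rewrite exprSr; nra.
have k12 : 2 * kappa1 <= 124 / 100 by rewrite /kappa1 mulrA ler_pdivrMr; lra.
split; try lra.
have : 115 / 100 <= s / (s + 1 - 2 * kappa1).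
  by rewrite ler_pdivlMr; lra.
lra.
Qed.

(** Here the sign of [fwd] at [j] is unknown, but the 20 vertices on the right keep it above
    [- X j / 7000] by [fwd_tail]. With [mu / (s + 1) <= 1 / 2600] and [s - 1 >= 3 / 5], the ratio
    stays below 1/1000. *)
Lemma inner_bwd_small j : (0 < j)%N -> (j + 20 <= M)%N -> load t kappa1 X j ->
  0 < fwd t X j.-1 /\ bwd t X j <= 1 / 1000 * (t * fwd t X j.-1).
Proof.
move=> j0 jM hj; have Xj : 0 < X j by apply: Xp; nlia.
have U : - fwd t X j <= X j / 7000.
  have := fwd_tail (ltac:(nlia) : (0 < j < M)%N).
  have := exprn_ge7000 (ltW s_bounds.1) (ltac:(nlia) : (19 <= M - 1 - j)%N).
  by rewrite ler_pdivlMr; [nra|lra].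
have m : mu / (s + 1) <= 1 / 2600.
  by move: (s_bounds.1) (mu_bounds) => s8 /andP[_ m1]; rewrite ler_pdivrMr; lra.
have V : bwd t X j <= (1 / 2600 + 1 / 7000) * X j.
  move: (load_fwd_bwd hj) (ler_wpM2r (ltW Xj) (hot_load (lexx kappa1))).
  by have := ler_wpM2r (ltW Xj) m; lra.
have tU : t * fwd t X j.-1 = (s - 1) * X j - bwd t X j.
  by rewrite -bwd_fwd_pred // addrC addKr.
have sX : 3 / 5 * X j <= (s - 1) * X j.
  by rewrite ler_pM2r //; move: (s_bounds.1); lra.
split; last by rewrite tU; lra.
by rewrite -(pmulr_rgt0 _ (_ : 0 < t)) ?tU; [lra|move: (t1); lra].
Qed.

(** For a gap of at most 9, [gap_bound] with the ratios [s] and 1/1000 would give 1 <= 91 * (33/20)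
    / 1000. *)
Lemma hot_gap_right i j : (1 < i < j)%N -> (j + 20 <= M)%N ->
  load t kappa1 X i -> load t kappa1 X j -> (9 < j - i)%N.
Proof.
move=> ij jM hi hj; rewrite ltnNge; apply/negP => le9.
have [Vi Ui] := hot_fwd_le (ltac:(nlia) : (1 < i <= M)%N) hi.
have [Uj Vj] := inner_bwd_small (ltac:(nlia) : (0 < j)%N) jM hj.
have s0 : 0 <= s by move: (s1); lra.
have := gap_bound (ltac:(nlia) : (0 < i < j)%N) (ltac:(nlia) : (j <= M)%N)
  s0 (ltac:(lra) : 0 <= 1 / 1000 :> R) Vi Uj Ui Vj.
have := exprn_le91 (ltW s1) (ltW s_bounds.2) le9.
move: (s_bounds.2) => s33 y91 h.
have : s ^+ (j - i) * s <= 91 * (33 / 20).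
  by apply: ler_pM => //; [rewrite exprn_ge0|exact: ltW].
move: h {y91}; lra.
Qed.

(* The reflection coefficient of an end carrying a pendant path on 2 vertices. *)
Definition omega := s * mu / (s ^+ 2 + s - 1).

Lemma omega_le : 0 < omega <= mu / s.
Proof.
facts_mu.
rewrite /omega divr_gt0 ?mulr_gt0 //; try nra.
rewrite ler_pdivrMr; last by nra.
rewrite mulrAC ler_pdivlMr; last by lra.
by have := mulr_gt0 m0 (ltac:(lra) : 0 < s - 1); lra.
Qed.

(** As in [interior_bwd_le], but with [kappa2] on both sides: [s - 2 * kappa2 = s * mu / (s ^+ 2 + s
    + 1)], and the denominator of [omega] is [s ^+ 3 - 1 - s * mu]. *)
Lemma heavy_end_fwd_le : (3 <= M)%N -> load t kappa2 X 3%N ->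
  fwd t X 3%N <= omega * (t * bwd t X 4%N).
Proof.
facts_mu.
move=> M3 /loadE h; have r := ratio2 (ltac:(nlia) : (2 < 3 <= M)%N).
have U : fwd t X 3%N <= (s - 2 * kappa2) * X 3%N by rewrite /fwd; lra.
have e := fwd_bwd_succ 3; move: (fwd t X 3%N) (t * bwd t X 4%N) e U => F B e U.
have q : 0 < s ^+ 2 + s + 1 by nra.
have k : s - 2 * kappa2 = s * mu / (s ^+ 2 + s + 1).
  by rewrite /kappa2 /mu; field; rewrite gt_eqF.
have eX : X 3%N = (F + B) / (s - 1) by rewrite e; field; rewrite !gt_eqF //; lra.
move: U; rewrite k eX.
have s3 : s ^+ 3 - 1 = (s ^+ 2 + s + 1) * (s - 1) by ring.
have -> : s * mu / (s ^+ 2 + s + 1) * ((F + B) / (s - 1)) = s * mu * (F + B) / (s ^+ 3 - 1).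
  rewrite s3.
  by field; rewrite !gt_eqF //; lra.
rewrite ler_pdivlMr; last by rewrite s3; apply: mulr_gt0 => //; lra.
move=> U; rewrite /omega mulrAC ler_pdivlMr; last by nra.
move: U; rewrite /mu; lra.
Qed.

End Supersolutions.

(** * Several attachment vertices on one path *)

Section ManyHotVertices.
Local Open Scope ring_scope.
Variables (R : realFieldType) (t s : R) (M : nat) (X : nat -> R).
Ltac nlia := lia_without R.
Hypotheses (t1 : 1 < t) (tts : t * t = s) (Xs : supersolution t M X).

Let Xs' := supersolution_mirror Xs.

Let s1 : 1 < s. Proof. by move: (t1) => h; rewrite -tts; nra. Qed.

Lemma bwd_mirror_succ j : (0 < j <= M)%N ->
  bwd t (mirror M X) (M.+1 - j).+1 = fwd t X j.-1.
Proof.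
move=> jM; have -> : (M.+1 - j).+1 = (M.+1 - j.-1)%N by nlia.
by apply: bwd_mirror; nlia.
Qed.

Lemma hot_bwd_le j : (0 < j < M)%N -> load t (kappa1 s) X j ->
  0 < fwd t X j.-1 /\ bwd t X j <= s * (t * fwd t X j.-1).
Proof.
move=> jM /(load_mirror (ltac:(nlia) : (0 < j <= M)%N)) hj.
have := hot_fwd_le t1 tts Xs' (ltac:(nlia) : (1 < M.+1 - j <= M)%N) hj.
by rewrite bwd_mirror_succ ?fwd_mirror //; nlia.
Qed.

Hypothesis mu_bounds : 0 < mu s <= 1 / 1000.

Lemma interior_fwd_le j : (0 < j <= M)%N -> load t (kappa1 s) X j ->
  0 <= bwd t X j -> fwd t X j <= mu s / s * (t * bwd t X j.+1).
Proof.
move=> jM /(load_mirror jM) hj V0.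
have := interior_bwd_le t1 tts Xs' mu_bounds (ltac:(nlia) : (0 < M.+1 - j <= M)%N) hj.
have -> : (M.+1 - j).-1 = (M.+1 - j.+1)%N by nlia.
by rewrite !fwd_mirror ?bwd_mirror; [exact|nlia..].
Qed.

(** A close pair near the right end is, on a path this long, far from the left end; the mirrored
    path then applies. *)
Lemma hot_gap i j : (1 < i < j)%N -> (j < M)%N -> (60 <= M)%N ->
  load t (kappa1 s) X i -> load t (kappa1 s) X j -> (9 < j - i)%N.
Proof.
move=> ij jM M60 hi hj; have [h|h] := leqP (j + 20) M.
  exact: (hot_gap_right t1 tts Xs mu_bounds ij h hi hj).
have [//|h'] := ltnP 9 (j - i).
have := hot_gap_right t1 tts Xs' mu_bounds
  (ltac:(nlia) : (1 < M.+1 - j < M.+1 - i)%N) (ltac:(nlia) : (M.+1 - i + 20 <= M)%N)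
  (load_mirror (ltac:(nlia) : (0 < j <= M)%N) hj)
  (load_mirror (ltac:(nlia) : (0 < i <= M)%N) hi).
nlia.
Qed.

(** Supplies the sign condition of [interior_fwd_le]: one attachment makes [bwd] positive at all
    later vertices. *)
Lemma bwd_gt0_right i j : (1 < i < j)%N -> (j <= M.+1)%N ->
  load t (kappa1 s) X i -> 0 < bwd t X j.
Proof.
move=> ij jM hi; have [V0 _] := hot_fwd_le t1 tts Xs (ltac:(nlia) : (1 < i <= M)%N) hi.
have := bwd_le t1 tts Xs (ltn0Sn i) (ltac:(nlia) : (i.+1 + (j - i.+1) <= M.+1)%N).
rewrite subnKC; last by nlia.
move/(lt_le_trans V0); rewrite pmulr_rgt0 // exprn_gt0 //; move: (t1); lra.
Qed.

Lemma fwd_gt0_left i j : (i < j < M)%N -> (0 < j)%N ->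
  load t (kappa1 s) X j -> 0 < fwd t X i.
Proof.
move=> ij j0 hj; have [U0 _] := hot_bwd_le (ltac:(nlia) : (0 < j < M)%N) hj.
have := fwd_le t1 tts Xs (ltac:(nlia) : (i + (j.-1 - i) <= M)%N).
rewrite subnKC; last by nlia.
move/(lt_le_trans U0); rewrite pmulr_rgt0 // exprn_gt0 //; move: (t1); lra.
Qed.

Let q0 : 0 <= mu s / s.
Proof. by case/andP: mu_bounds => m0 _; rewrite divr_ge0 // ltW // (lt_trans ltr01 s1). Qed.

Let s0 : 0 <= s. Proof. by move: (s1); lra. Qed.

(** The product of three gap bounds. The first vertex contributes one small ratio, the second and
    third two each, and the last only the crude [s]. *)
Lemma four_hot h1 h2 h3 h4 : (1 < h1 < h2)%N -> (h2 < h3 < h4)%N -> (h4 < M)%N ->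
  load t (kappa1 s) X h1 -> load t (kappa1 s) X h2 ->
  load t (kappa1 s) X h3 -> load t (kappa1 s) X h4 ->
  fwd t X h1 <= mu s / s * (t * bwd t X h1.+1) ->
  1 <= s ^+ (h4 - h1) * ((mu s / s) ^+ 5 * s).
Proof.
move=> h12 h34 hM l1 l2 l3 l4 U1.
have V1 := bwd_gt0_right (ltac:(nlia) : (1 < h1 < h1.+1)%N) (ltac:(nlia) : (h1.+1 <= M.+1)%N) l1.
have V2 := bwd_gt0_right (ltac:(nlia) : (1 < h1 < h2)%N) (ltac:(nlia) : (h2 <= M.+1)%N) l1.
have V2' := bwd_gt0_right (ltac:(nlia) : (1 < h1 < h2.+1)%N) (ltac:(nlia) : (h2.+1 <= M.+1)%N) l1.
have V3 := bwd_gt0_right (ltac:(nlia) : (1 < h1 < h3)%N) (ltac:(nlia) : (h3 <= M.+1)%N) l1.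
have V3' := bwd_gt0_right (ltac:(nlia) : (1 < h1 < h3.+1)%N) (ltac:(nlia) : (h3.+1 <= M.+1)%N) l1.
have U2 := fwd_gt0_left (ltac:(nlia) : (h2 < h4 < M)%N) (ltac:(nlia) : (0 < h4)%N) l4.
have U2' := fwd_gt0_left (ltac:(nlia) : (h2.-1 < h4 < M)%N) (ltac:(nlia) : (0 < h4)%N) l4.
have U3 := fwd_gt0_left (ltac:(nlia) : (h3 < h4 < M)%N) (ltac:(nlia) : (0 < h4)%N) l4.
have U3' := fwd_gt0_left (ltac:(nlia) : (h3.-1 < h4 < M)%N) (ltac:(nlia) : (0 < h4)%N) l4.
have U4' := fwd_gt0_left (ltac:(nlia) : (h4.-1 < h4 < M)%N) (ltac:(nlia) : (0 < h4)%N) l4.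
have b2 := interior_bwd_le t1 tts Xs mu_bounds (ltac:(nlia) : (0 < h2 <= M)%N) l2 (ltW U2).
have f2 := interior_fwd_le (ltac:(nlia) : (0 < h2 <= M)%N) l2 (ltW V2).
have b3 := interior_bwd_le t1 tts Xs mu_bounds (ltac:(nlia) : (0 < h3 <= M)%N) l3 (ltW U3).
have f3 := interior_fwd_le (ltac:(nlia) : (0 < h3 <= M)%N) l3 (ltW V3).
have [_ b4] := hot_bwd_le (ltac:(nlia) : (0 < h4 < M)%N) l4.
have g12 := gap_bound t1 tts Xs (ltac:(nlia) : (0 < h1 < h2)%N) (ltac:(nlia) : (h2 <= M)%N)
  q0 q0 V1 U2' U1 b2.
have g23 := gap_bound t1 tts Xs (ltac:(nlia) : (0 < h2 < h3)%N) (ltac:(nlia) : (h3 <= M)%N)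
  q0 q0 V2' U3' f2 b3.
have g34 := gap_bound t1 tts Xs (ltac:(nlia) : (0 < h3 < h4)%N) (ltac:(nlia) : (h4 <= M)%N)
  q0 s0 V3' U4' f3 b4.
have -> : (h4 - h1 = (h2 - h1) + (h3 - h2) + (h4 - h3))%N by nlia.
rewrite !exprD; set q := mu s / s in g12 g23 g34 *.
have -> : s ^+ (h2 - h1) * s ^+ (h3 - h2) * s ^+ (h4 - h3) * (q ^+ 5 * s) =
  (s ^+ (h2 - h1) * (q * q)) * (s ^+ (h3 - h2) * (q * q)) * (s ^+ (h4 - h3) * (q * s)).
  by ring.
by apply: mulr_ege1 => //; apply: mulr_ege1.
Qed.

(** Each heavy end bounds from below the component leaving it at [h], while the pendant vertex at
    [h] bounds the sum of the two components by [mu / (s + 1) * X h]. *)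
Lemma heavy_ends_hot_middle h : (3 < h)%N -> (h < M - 2)%N ->
  load t (kappa2 s) X 3%N -> load t (kappa1 s) X h -> load t (kappa2 s) X (M - 2)%N ->
  1 / (1 + omega s * s ^+ (h - 3)) + 1 / (1 + omega s * s ^+ (M - 2 - h)) <=
  mu s / (s ^+ 2 - 1).
Proof.
move=> h3 hM l3 lh lM.
have [w0 _] := andP (omega_le t1 tts mu_bounds).
(* Reflection at the heavy end gives [t * fwd] at [g.-1] at most [omega s * s ^+ (g - 3)] times
   [bwd] at [g]; adding [bwd] yields [(s - 1) * Y g]. The right half is the mirrored path. *)
have half (Y : nat -> R) g : supersolution t M Y -> (3 < g)%N -> (g < M)%N ->
    load t (kappa2 s) Y 3%N -> load t (kappa1 s) Y g ->
    (s - 1) * Y g / (1 + omega s * s ^+ (g - 3)) <= bwd t Y g.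
  move=> Ys g3 gM k3 kg.
  have Y3 : 0 < Y 3%N by case: Ys => _ _ h' _; apply: h'; nlia.
  have U := heavy_end_fwd_le t1 tts Ys mu_bounds (ltac:(nlia) : (3 <= M)%N) k3.
  have f := fwd_le t1 tts Ys (ltac:(nlia) : (3 + (g.-1 - 3) <= M)%N).
  have b := bwd_le t1 tts Ys (ltac:(nlia) : (0 < 4)%N) (ltac:(nlia) : (4 + (g - 4) <= M.+1)%N).
  rewrite !subnKC in f b; [|nlia..].
  have e := bwd_fwd_pred Y tts (ltac:(nlia) : (0 < g)%N).
  have t0 : 0 < t by move: (t1); lra.
  rewrite ler_pdivrMr; last by rewrite addr_gt0 // mulr_gt0 // exprn_gt0; move: (s1); lra.
  rewrite -e [bwd t Y g * _]mulrDr mulr1 lerD2l.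
  apply: le_trans (_ : t * (t ^+ (g.-1 - 3) * (omega s * (t * (t ^+ (g - 4) * bwd t Y g)))) <= _).
    rewrite ler_pM2l //; apply: le_trans f _; rewrite ler_pM2l ?exprn_gt0 //.
    apply: le_trans U _; rewrite ler_pM2l // ler_pM2l //.
  have -> : (g.-1 - 3 = g - 4)%N by nlia.
  have -> : (g - 3 = (g - 4).+1)%N by nlia.
  rewrite exprS -tts exprMn.
  by rewrite le_eqVlt; apply/orP; left; apply/eqP; ring.
have hl := half X h Xs h3 (ltac:(nlia)) l3 lh.
have e3 : (M.+1 - (M - 2) = 3)%N by nlia.
have lM' := load_mirror (ltac:(nlia) : (0 < M - 2 <= M)%N) lM; rewrite e3 in lM'.
have hr := half (mirror M X) (M.+1 - h)%N Xs' (ltac:(nlia)) (ltac:(nlia)) lM'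
  (load_mirror (ltac:(nlia) : (0 < h <= M)%N) lh).
have eX : mirror M X (M.+1 - h) = X h by rewrite /mirror subKn //; nlia.
have eh : (M.+1 - h - 3 = M - 2 - h)%N by nlia.
rewrite bwd_mirror ?eX ?eh in hr; last by nlia.
have := load_fwd_bwd tts lh; have := hot_load t1 tts mu_bounds (lexx (kappa1 s)).
have Xh : 0 < X h by case: Xs => _ _ h' _; apply: h'; nlia.
have sX : 0 < (s - 1) * X h by rewrite mulr_gt0 //; move: (s1); lra.
rewrite -(ler_pM2r Xh) => k1 k2; rewrite -(ler_pM2l sX).
have -> : (s - 1) * X h * (mu s / (s ^+ 2 - 1)) = mu s / (s + 1) * X h.
  have -> : s ^+ 2 - 1 = (s - 1) * (s + 1) by ring.
  by field; rewrite !gt_eqF //; move: (s1); lra.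
by rewrite mulrDr !mul1r; lra.
Qed.

End ManyHotVertices.

(** * Paths with two heavy ends: the equality case and the sign of mu *)

Section ExactSolutions.
Local Open Scope ring_scope.
Variables (R : realFieldType) (t s : R).
Ltac nlia := lia_without R.
Hypotheses (t1 : 1 < t) (tts : t * t = s).

Let s1 : 1 < s. Proof. by move: (t1) => h; rewrite -tts; nra. Qed.

Definition exact_load k (X : nat -> R) i :=
  t * X i.-1 + t * X i.+1 + k * X i = (s + 1) * X i.

(** When the recurrence holds with equality, [fwd] and [bwd] are exactly geometric between the
    loads, so the estimate for one half in [heavy_ends_hot_middle] becomes an identity. *)
Lemma exact_bwd (X : nat -> R) h : (3 < h)%N -> X 0%N = 0 ->
  (forall i, (0 < i < h)%N -> i <> 3%N -> exact_load 0 X i) ->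
  exact_load (kappa2 s) X 3%N ->
  bwd t X h * (1 + omega s * s ^+ (h - 3)) = (s - 1) * X h.
Proof.
move=> h3 X0 ex ex3; have := t1; have := s1 => s1' t1'.
have ts := tts; have t0 : t != 0 by rewrite gt_eqF //; lra.
have e1 := ex 1 (ltac:(nlia)) (ltac:(nlia)); have e2 := ex 2 (ltac:(nlia)) (ltac:(nlia)).
rewrite /exact_load /= in e1 e2 ex3.
have q : s ^+ 2 + s + 1 != 0 by rewrite gt_eqF //; nra.
have x2 : t * X 2%N = (s + 1) * X 1%N by rewrite X0 in e1; lra.
have x12 : t * X 1%N = s * X 2%N / (s + 1).
  apply: (mulIf (_ : s + 1 != 0)); first by rewrite gt_eqF //; lra.
  rewrite divfK; last by rewrite gt_eqF //; lra.
  by rewrite -tts -!mulrA x2 -tts; ring.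
have x23 : t * X 2%N = kappa2 s * X 3%N.
  apply: (mulfI t0); rewrite /kappa2.
  have : t * X 3%N = (s ^+ 2 + s + 1) / (s + 1) * X 2%N.
    have -> : t * X 3%N = (s + 1) * X 2%N - t * X 1%N by lra.
    by rewrite x12; field; rewrite gt_eqF //; lra.
  move=> e; rewrite [RHS]mulrCA e mulrA ts; field.
  by rewrite q /= gt_eqF //; lra.
have U3 : fwd t X 3%N = (s - 2 * kappa2 s) * X 3%N.
  by rewrite /fwd; move: ex3; rewrite x23; lra.
have fE d : (3 + d < h)%N -> fwd t X (3 + d) = t ^+ d * fwd t X 3%N.
  elim: d => [|d IH] dh; first by rewrite addn0 expr0 mul1r.
  have := ex (3 + d.+1)%N (ltac:(nlia)) (ltac:(nlia)).
  rewrite exprS -mulrA -IH; last by nlia.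
  by rewrite /exact_load /fwd addnS /= -tts; lra.
have bE d : (4 + d <= h)%N -> bwd t X 4%N = t ^+ d * bwd t X (4 + d).
  elim: d => [|d IH] dh; first by rewrite addn0 expr0 mul1r.
  rewrite IH; last by nlia.
  have := ex (4 + d)%N (ltac:(nlia)) (ltac:(nlia)).
  rewrite exprSr -mulrA /exact_load /bwd addnS /= => e; congr (_ * _).
  by rewrite mulrBr mulrA tts; lra.
have f := fE (h - 4)%N (ltac:(nlia)); have b := bE (h - 4)%N (ltac:(nlia)).
have eh : (4 + (h - 4) = h)%N by nlia.
have eh1 : (3 + (h - 4) = h.-1)%N by nlia.
rewrite eh in b; rewrite eh1 in f.
have := bwd_fwd_pred X tts (ltac:(nlia) : (0 < h)%N) => <-.
rewrite mulrDr mulr1; congr (_ + _); rewrite f.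
have w : fwd t X 3%N = omega s * (t * bwd t X 4%N).
  have e := fwd_bwd_succ X tts 3.
  have -> : t * bwd t X 4%N = (s - 1) * X 3%N - fwd t X 3%N by rewrite -e addrC addKr.
  rewrite U3 /omega /kappa2 /mu; field.
  by rewrite q /= gt_eqF //; nra.
rewrite w b; have -> : (h - 3 = (h - 4).+1)%N by nlia.
by rewrite exprS -tts exprMn; ring.
Qed.

Lemma exact_heavy_ends M (X : nat -> R) h : (3 < h)%N -> (h < M - 2)%N ->
  X 0%N = 0 -> X M.+1 = 0 -> 0 < X h -> 0 < mu s ->
  (forall i, (0 < i <= M)%N -> i <> 3%N -> i <> h -> i <> (M - 2)%N -> exact_load 0 X i) ->
  exact_load (kappa2 s) X 3%N -> exact_load (kappa1 s) X h ->
  exact_load (kappa2 s) X (M - 2)%N ->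
  mu s / (s ^+ 2 - 1) =
  1 / (1 + omega s * s ^+ (h - 3)) + 1 / (1 + omega s * s ^+ (M - 2 - h)).
Proof.
move=> h3 hM X0 XM Xh m0 ex e3 eh eM; have s1' := s1.
have w0 : 0 < omega s by rewrite /omega divr_gt0 ?mulr_gt0 //; [lra|nra].
have b := exact_bwd h3 X0 (fun i ih i3 => ex i ltac:(nlia) i3 ltac:(nlia) ltac:(nlia)) e3.
have mir k i : (0 < i <= M)%N -> exact_load k X i ->
    exact_load k (mirror M X) (M.+1 - i)%N.
  move=> iM; rewrite /exact_load /mirror.
  have -> : (M.+1 - (M.+1 - i) = i)%N by nlia.
  have -> : (M.+1 - (M.+1 - i).-1 = i.+1)%N by nlia.
  have -> : (M.+1 - (M.+1 - i).+1 = i.-1)%N by nlia.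
  by rewrite [t * X i.+1 + _]addrC.
have eM3 : (M.+1 - (M - 2) = 3)%N by nlia.
have f : bwd t (mirror M X) (M.+1 - h) * (1 + omega s * s ^+ (M.+1 - h - 3)) =
    (s - 1) * mirror M X (M.+1 - h).
  apply: exact_bwd => [||i ih i3|]; first by nlia.
  - by rewrite /mirror subn0.
  - have -> : i = (M.+1 - (M.+1 - i))%N by nlia.
    by apply: mir; [nlia|apply: ex; nlia].
  - by rewrite -eM3; apply: mir => //; nlia.
have eX : mirror M X (M.+1 - h) = X h by rewrite /mirror subKn //; nlia.
have e' : (M.+1 - h - 3 = M - 2 - h)%N by nlia.
rewrite bwd_mirror ?eX ?e' in f; last by nlia.
set A := 1 + _ in b; set B := 1 + _ in f.
have A0 : 0 < A by rewrite addr_gt0 // mulr_gt0 // exprn_gt0; lra.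
have B0 : 0 < B by rewrite addr_gt0 // mulr_gt0 // exprn_gt0; lra.
have sX : (s - 1) * X h != 0 by rewrite mulf_neq0 // gt_eqF //; lra.
have -> : 1 / A = bwd t X h / ((s - 1) * X h).
  by apply: (mulIf sX); rewrite divfK // -b; field; rewrite gt_eqF.
have -> : 1 / B = fwd t X h / ((s - 1) * X h).
  by apply: (mulIf sX); rewrite divfK // -f; field; rewrite gt_eqF.
apply: (mulIf sX); rewrite -mulrDl divfK //.
have -> : mu s / (s ^+ 2 - 1) * ((s - 1) * X h) = mu s / (s + 1) * X h.
  have -> : s ^+ 2 - 1 = (s - 1) * (s + 1) by ring.
  by field; rewrite !gt_eqF //; lra.
have -> : mu s / (s + 1) = s - 1 - kappa1 s.
  by rewrite /mu /kappa1; field; rewrite gt_eqF //; lra.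
by move: eh; rewrite /exact_load /fwd /bwd; lra.
Qed.

(** If [mu] were nonpositive, both ends would send a nonpositive component towards [h]. Then
    [fwd + bwd] at [h] would be at least [2 * (s - 1) * X h], whereas the load there makes it
    nonpositive. *)
Lemma heavy_ends_mu_gt0 M (X : nat -> R) h : supersolution t M X ->
  (3 < h)%N -> (h < M - 2)%N -> load t (kappa2 s) X 3%N -> load t (kappa1 s) X h ->
  load t (kappa2 s) X (M - 2)%N -> 0 < mu s.
Proof.
move=> Xs h3 hM l3 lh lM; rewrite ltNge; apply/negP => m0.
have s1' := s1; have t1' := t1.
have half (Y : nat -> R) g : supersolution t M Y -> (3 < g)%N -> (g < M)%N ->
    load t (kappa2 s) Y 3%N -> (s - 1) * Y g <= bwd t Y g.
  move=> Ys g3 gM /(loadE _ tts) k3.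
  have Y3 : 0 < Y 3%N by case: Ys => _ _ h' _; apply: h'; nlia.
  have r := ratio2 t1 tts Ys (ltac:(nlia) : (2 < 3 <= M)%N); rewrite /= in r k3.
  have k : s - 2 * kappa2 s <= 0.
    have -> : s - 2 * kappa2 s = s * mu s / (s ^+ 2 + s + 1).
      by rewrite /kappa2 /mu; field; rewrite gt_eqF //; nra.
    by rewrite ler_pdivrMr ?mul0r ?pmulr_rle0 //; nra.
  have U : fwd t Y 3%N <= 0.
    apply: (@le_trans _ _ ((s - 2 * kappa2 s) * Y 3%N)); last by rewrite pmulr_lle0.
    by rewrite /fwd; lra.
  have := fwd_le t1 tts Ys (ltac:(nlia) : (3 + (g.-1 - 3) <= M)%N).
  rewrite subnKC; last by nlia.
  have tg : 0 < t ^+ (g.-1 - 3) by rewrite exprn_gt0; lra.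
  move=> f; have U' : fwd t Y g.-1 <= 0.
    by apply: le_trans f _; rewrite pmulr_rle0.
  rewrite -(bwd_fwd_pred Y tts); last by nlia.
  by rewrite gerDl pmulr_rle0 //; lra.
have hl := half X h Xs h3 (ltac:(nlia)) l3.
have e3 : (M.+1 - (M - 2) = 3)%N by nlia.
have lM' := load_mirror (ltac:(nlia) : (0 < M - 2 <= M)%N) lM; rewrite e3 in lM'.
have := half (mirror M X) (M.+1 - h)%N (supersolution_mirror Xs) (ltac:(nlia)) (ltac:(nlia)) lM'.
have eX : mirror M X (M.+1 - h) = X h by rewrite /mirror subKn //; nlia.
rewrite bwd_mirror ?eX; last by nlia.
have Xh : 0 < X h by case: Xs => _ _ h' _; apply: h'; nlia.
have k1 : s - 1 - kappa1 s <= 0.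
  have -> : s - 1 - kappa1 s = mu s / (s + 1).
    by rewrite /mu /kappa1; field; rewrite gt_eqF //; lra.
  by rewrite ler_pdivrMr ?mul0r //; lra.
have := load_fwd_bwd tts lh; have := ler_wpM2r (ltW Xh) k1.
have sX : 0 < (s - 1) * X h by rewrite mulr_gt0 //; lra.
move: hl sX; lra.
Qed.

End ExactSolutions.

(** * Balanced gaps and the size of mu *)

Section Balance.
Local Open Scope ring_scope.
Variable R : realFieldType.
Ltac nlia := lia_without R.

Lemma recip_sum (A B : R) : 0 < A -> 0 < B ->
  1 / (1 + A) + 1 / (1 + B) = 1 - (A * B - 1) / (1 + (A + B) + A * B).
Proof.
move=> A0 B0; have AB := mulr_gt0 A0 B0; field.
by rewrite !gt_eqF //; lra.
Qed.

(** Both pairs give the same product of [A] and [B] in [recip_sum], and the bound by 1 makes it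
    exceed 1. The left side then increases with [A + B], which is strictly larger for unbalanced
    exponents. *)
Lemma balanced_sum (s w : R) d1 d2 e1 e2 : 1 < s -> 0 < w ->
  (e1 + e2 = d1 + d2)%N -> (d1 <= d2 <= d1.+1)%N ->
  1 / (1 + w * s ^+ d1) + 1 / (1 + w * s ^+ d2) < 1 ->
  1 / (1 + w * s ^+ e1) + 1 / (1 + w * s ^+ e2) <=
    1 / (1 + w * s ^+ d1) + 1 / (1 + w * s ^+ d2) ->
  (e1 = d1 /\ e2 = d2) \/ (e1 = d2 /\ e2 = d1).
Proof.
move=> s1 w0 ed d12.
have p n : 0 < w * s ^+ n by rewrite mulr_gt0 // exprn_gt0 //; lra.
(* As [d1] and [d2] differ by at most one, a different pair with the same sum has its minimum below
   [d1]. *)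
have [i iE] : exists i, i = minn e1 e2 by eexists.
have [//|lt] : ((e1 = d1 /\ e2 = d2) \/ (e1 = d2 /\ e2 = d1)) \/ (i < d1)%N by nlia.
rewrite !recip_sum //; set P := w * s ^+ d1 * _.
have -> : w * s ^+ e1 * (w * s ^+ e2) = P.
  have -> a b : w * s ^+ a * (w * s ^+ b) = w ^+ 2 * s ^+ (a + b) by rewrite exprD; ring.
  by rewrite ed /P exprD; ring.
have P0 : 0 < P by apply: mulr_gt0.
have S1 := p d1; have S2 := p d2; have S3 := p e1; have S4 := p e2.
set S := w * s ^+ d1 + w * s ^+ d2; set S' := w * s ^+ e1 + w * s ^+ e2.
have SS : S < S'.
  have {S1 S2 S3 S4 P P0}-> : S' = w * (s ^+ i + s ^+ (e1 + e2 - i)).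
    rewrite /S' -mulrDr iE; have [h|h] := leqP e1 e2.
      by have -> : (e1 + e2 - e1 = e2)%N by nlia.
    by have -> : (e1 + e2 - e2 = e1)%N by [nlia]; rewrite addrC.
  rewrite /S -mulrDr ltr_pM2l // ed.
  have -> : (d1 + d2 - i = d2 + (d1 - i))%N by nlia.
  have -> : s ^+ d1 = s ^+ i * s ^+ (d1 - i) by rewrite -exprD; congr (_ ^+ _); nlia.
  have -> : s ^+ d2 = s ^+ i * s ^+ (d2 - i) by rewrite -exprD; congr (_ ^+ _); nlia.
  rewrite exprD.
  have -> : s ^+ d2 = s ^+ i * s ^+ (d2 - i) by rewrite -exprD; congr (_ ^+ _); nlia.
  rewrite -mulrA -[X in _ < X + _]mulr1 -!mulrDr ltr_pM2l; last by rewrite exprn_gt0 //; lra.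
  (* With [u1 = s ^+ (d1 - i)] and [u2 = s ^+ (d2 - i)], the claim is that [(u1 - 1) * (u2 - 1)] is
     positive. *)
  have u1 : 1 < s ^+ (d1 - i) by rewrite exprn_egt1 //; nlia.
  have u2 : 1 < s ^+ (d2 - i) by rewrite exprn_egt1 //; nlia.
  nra.
move=> h1 h2; exfalso.
have D0 : 0 < 1 + S + P by rewrite /S; lra.
have D0' : 0 < 1 + S' + P by rewrite /S'; lra.
have P1 : 0 < P - 1.
  have : 0 < (P - 1) / (1 + S + P) by lra.
  by rewrite pmulr_lgt0 // invr_gt0.
have : (P - 1) / (1 + S + P) <= (P - 1) / (1 + S' + P) by lra.
rewrite ler_pM2l // lef_pV2 ?posrE //; lra.
Qed.

(** Both reciprocals are at most [1 / (omega s * s ^+ d)], and [omega] is itself proportional to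
    [mu] up to bounded factors. Hence the square of [mu]. *)
Lemma mu_bound (s : R) d d' : 1 < s -> 0 < mu s -> (d <= d')%N ->
  mu s / (s ^+ 2 - 1) = 1 / (1 + omega s * s ^+ d) + 1 / (1 + omega s * s ^+ d') ->
  mu s ^+ 2 * s ^+ d.+1 <= 2 * (s ^+ 2 - 1) * (s ^+ 2 + s - 1).
Proof.
move=> s1 m0 dd e.
have w0 : 0 < omega s by rewrite /omega divr_gt0 ?mulr_gt0 //; [lra|nra].
have sd : 0 < s ^+ d by rewrite exprn_gt0 //; lra.
have h n : (d <= n)%N -> 1 / (1 + omega s * s ^+ n) <= 1 / (omega s * s ^+ d).
  move=> dn; have sn : s ^+ d <= s ^+ n by rewrite ler_weXn2l //; lra.
  have : omega s * s ^+ d <= omega s * s ^+ n by rewrite ler_pM2l.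
  have wd := mulr_gt0 w0 sd => wdn.
  rewrite ler_pM2l // lef_pV2 ?posrE; lra.
have : mu s / (s ^+ 2 - 1) <= 2 / (omega s * s ^+ d).
  by have := h d (leqnn d); have := h d' dd; rewrite e; lra.
rewrite ler_pdivrMr; last by nra.
rewrite mulrAC ler_pdivlMr; last by apply: mulr_gt0.
rewrite /omega; have -> : mu s * (s * mu s / (s ^+ 2 + s - 1) * s ^+ d) =
   mu s ^+ 2 * s ^+ d.+1 / (s ^+ 2 + s - 1).
  by rewrite [s ^+ d.+1]exprS; field; rewrite gt_eqF //; nra.
by rewrite ler_pdivrMr //; nra.
Qed.

Lemma mu_small (s : R) d : 1 < s -> 0 < mu s -> (40 <= d)%N ->
  mu s ^+ 2 * s ^+ d.+1 <= 2 * (s ^+ 2 - 1) * (s ^+ 2 + s - 1) ->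
  mu s <= 1 / 1000.
Proof.
move=> s1 m0 d40 h.
have s8 : 8 / 5 <= s by rewrite leNgt; apply/negP => lt; move: m0; rewrite /mu; nra.
have h2 : 2 * (s ^+ 2 - 1) * (s ^+ 2 + s - 1) <= 4 * s ^+ 4.
  have -> : 4 * s ^+ 4 = (2 * s ^+ 2) * (2 * s ^+ 2) by ring.
  by apply: ler_pM; nra.
have e : s ^+ d.+1 = s ^+ (d - 3) * s ^+ 4 by rewrite -exprD; congr (_ ^+ _); nlia.
have s4 : 0 < s ^+ 4 by rewrite exprn_gt0 //; lra.
have h3 : mu s ^+ 2 * s ^+ (d - 3) <= 4.
  by rewrite -(ler_pM2r s4) -mulrA -e; lra.
(* Since [s >= 8 / 5], [s ^+ 35 = s ^+ 15 * s ^+ 15 * s ^+ 5] is at least 1000 * 1000 * 10. *)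
have [K KE] : exists K : R, K = 1000 by eexists.
have a15 : K <= s ^+ 15.
  by apply: le_trans (exprn_ge_mono _ s8 (leqnn 15)); lra.
have a5 : 10 <= s ^+ 5 by apply: le_trans (exprn_ge_mono _ s8 (leqnn 5)); lra.
have K0 : 0 < K by lra.
have s35 : s ^+ 35 <= s ^+ (d - 3) by rewrite ler_weXn2l //; [lra|nlia].
have KK : K * K * 10 <= s ^+ 35.
  have -> : s ^+ 35 = s ^+ 15 * s ^+ 15 * s ^+ 5 by rewrite -!exprD.
  have KK0 : 0 <= K * K by rewrite mulr_ge0 // ltW.
  by apply: ler_pM => //; apply: ler_pM => //; apply: ltW.
have m2 : 0 < mu s ^+ 2 by rewrite exprn_gt0.
have h4 : mu s ^+ 2 * (K * K * 10) <= 4.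
  apply: le_trans h3; rewrite ler_pM2l //; exact: le_trans s35.
have h5 : (mu s * K) ^+ 2 <= 1 ^+ 2.
  have -> : (mu s * K) ^+ 2 = mu s ^+ 2 * (K * K * 10) / 10 by field.
  by rewrite ler_pdivrMr; lra.
have h6 : mu s * K <= 1.
  by move: h5; rewrite ler_pXn2r ?nnegrE //; apply: mulr_ge0; exact: ltW.
by rewrite ler_pdivlMr -?KE.
Qed.

(** The power [s ^+ (2 * d + 4)] absorbs four factors [mu] through [mu_bound]; the fifth one
    remains. Numerically the product is at most 13^2 / 1000 before division by [s ^+ 2]. *)
Lemma mu_too_small (s : R) d n : 1 < s -> 0 < mu s <= 1 / 1000 -> (n <= 2 * d + 4)%N ->
  mu s ^+ 2 * s ^+ d.+1 <= 2 * (s ^+ 2 - 1) * (s ^+ 2 + s - 1) ->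
  s ^+ n * ((mu s / s) ^+ 5 * s) < 1.
Proof.
move=> s1 /andP[m0 m1] nd h.
have s2 : s <= 33 / 20 by rewrite leNgt; apply/negP => lt; move: m1; rewrite /mu; nra.
have h2 : 2 * (s ^+ 2 - 1) * (s ^+ 2 + s - 1) <= 13.
  have a1 : s ^+ 2 - 1 <= 18 / 10 by nra.
  have a2 : s ^+ 2 + s - 1 <= 36 / 10 by nra.
  have a3 : 0 <= s ^+ 2 - 1 by nra.
  have a4 : 0 <= s ^+ 2 + s - 1 by nra.
  have := ler_pM a3 a4 a1 a2; lra.
have s0 : 0 < s by lra.
have q0 : 0 < (mu s / s) ^+ 5 * s by rewrite mulr_gt0 ?exprn_gt0 ?divr_gt0.
have sn : s ^+ n <= s ^+ (2 * d + 4) by rewrite ler_weXn2l //; lra.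
apply: le_lt_trans (ler_wpM2r (ltW q0) sn) _.
have -> : s ^+ (2 * d + 4) * ((mu s / s) ^+ 5 * s) = (mu s ^+ 2 * s ^+ d.+1) ^+ 2 * mu s / s ^+ 2.
  have -> : (2 * d + 4 = d.+1 + d.+1 + 2)%N by nlia.
  by rewrite !exprD; field; rewrite gt_eqF.
rewrite ltr_pdivrMr ?exprn_gt0 // mul1r.
have p0 : 0 <= mu s ^+ 2 * s ^+ d.+1 by rewrite mulr_ge0 // exprn_ge0 // ltW.
have : (mu s ^+ 2 * s ^+ d.+1) ^+ 2 <= 13 ^+ 2.
  by rewrite ler_pXn2r ?nnegrE //; lra.
move=> h3; have := ler_pM (sqr_ge0 _) (ltW m0) h3 m1; nra.
Qed.

End Balance.

(** * Vertices outside of a geodesic *)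

Section PathVertices.
Variables (G : sgraph) (D : nat).
Implicit Type v : nat -> G.

Definition outer v (u : G) : bool := all (fun i => v i != u) (iota 0 D.+1).

Lemma outerP v u : reflect (forall i, i <= D -> v i != u) (outer v u).
Proof.
apply: (iffP allP) => h i; last by rewrite mem_iota => /andP[_ iD]; apply: h.
by move=> iD; apply: h; rewrite mem_iota.
Qed.

Lemma outerPn v u : ~~ outer v u -> exists2 i, i <= D & u = v i.
Proof.
case/allPn => i; rewrite mem_iota => /andP[_ iD]; rewrite negbK => /eqP e.
by exists i.
Qed.

Lemma outer_rev v u : outer (fun i => v (D - i)) u = outer v u.
Proof.
apply/outerP/outerP => h i iD; last by apply: h; rewrite leq_subr.
by have := h (D - i) (leq_subr _ _); rewrite subKn.
Qed.

Lemma card_outer v : geodesic D v -> #|outer v| + D.+1 = #|G|.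
Proof.
move=> gv; rewrite -(cardC (outer v)) /=; congr (_ + _).
pose s := [seq v i | i <- iota 0 D.+1].
have us : uniq s.
  rewrite map_inj_in_uniq ?iota_uniq // => i j.
  by rewrite !mem_iota => /andP[_ iD] /andP[_ jD]; exact: (geodesic_inj gv iD jD).
have -> : D.+1 = size s by rewrite size_map size_iota.
rewrite -(card_uniqP us); apply: eq_card => u; rewrite [RHS]inE /=.
apply/mapP/idP => [[i]|]; last first.
  by move=> /outerPn[i iD ->]; exists i => //; rewrite mem_iota.
rewrite mem_iota => /andP[_ iD] ->; apply/negP => /outerP /(_ i iD).
by rewrite eqxx.
Qed.

Lemma first_path_vertex v k u p : k <= D -> outer v u -> path (@adj G) u p ->
  last u p = v k -> exists p1 j p2, [/\ p = p1 ++ v j :: p2, j <= D,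
    all (outer v) (u :: p1), adj (last u p1) (v j) &
    has_walk u (last u p1) (size p1) /\ has_walk (v j) (v k) (size p2)].
Proof.
move=> kD; elim: p u => [|a p IH] u ou /=.
  by move=> _ uk; move/outerP/(_ k kD): ou; rewrite uk eqxx.
move=> /andP[ua pp] lp; case: (boolP (outer v a)) => [oa|].
  have [p1 [j [p2 [-> jD op lj [w1 w2]]]]] := IH a oa pp lp.
  exists (a :: p1), j, p2; split=> //=; first by rewrite ou.
  by split=> //; apply: (has_walk_cat (a := 1)) w1; apply: has_walk1.
case/outerPn => j jD aj; exists [::], j, p; rewrite /= ou -aj; split=> //.
by split; [exact: has_walk0|apply/has_walkP; exists p].
Qed.

End PathVertices.

Ltac graph_lia R := repeat match goal with H : ?T |- _ =>
  match T with
  | context [R] => clear H | context [@adj] => clear H | context [@outer] => clear H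
  | context [@has_walk] => clear H | context [@uniq] => clear H
  | context [@geodesic] => clear H end end; lia.

(** * Local restrictions on a graph of spectral radius at most that of the tree *)

Section Competitor.
Local Open Scope ring_scope.
Variables (R : realType) (t s : R) (G : sgraph) (D : nat) (x : G -> R).
Ltac nlia := graph_lia R.
Hypotheses (t1 : 1 < t) (tts : t * t = s) (x0 : forall u, 0 < x u).
Hypothesis xsuper : forall u, t * nbsum x u <= (s + 1) * x u.

Let s1 : 1 < s. Proof. by move: (t1) => h; rewrite -tts; nra. Qed.
Let t0 : 0 < t. Proof. by move: (t1); lra. Qed.

Lemma nbsum_ge_seq (a : G) (l : seq G) :
  uniq l -> all (adj a) l -> \sum_(b <- l) x b <= nbsum x a.
Proof.
move=> ul al; rewrite big_uniq //= /nbsum.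
rewrite big_mkcond [leRHS]big_mkcond /=; apply: ler_sum => b _.
case: ifP => [bl|_]; first by rewrite (allP al _ bl).
by case: ifP => // _; exact: ltW.
Qed.

Lemma super_seq (a : G) (l : seq G) :
  uniq l -> all (adj a) l -> t * (\sum_(b <- l) x b) <= (s + 1) * x a.
Proof.
move=> ul al; apply: le_trans (xsuper a); rewrite ler_pM2l //.
exact: nbsum_ge_seq.
Qed.

(** The analogue of [ratio_step] off the path: weight at the other neighbours [l] of [w] raises the
    weight of [w] relative to [a]. The graph may contain cycles. *)
Lemma weight_step a w l c : adj w a -> uniq (a :: l) -> all (adj w) l ->
  c * x w <= t * (\sum_(b <- l) x b) -> c < s + 1 ->
  s / (s + 1 - c) * x a <= t * x w.
Proof.
move=> wa ul al hc c1.
have := super_seq ul (_ : all (adj w) (a :: l)).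
rewrite /= wa al big_cons => /(_ isT) h.
rewrite mulrAC ler_pdivrMr; last by lra.
have -> : s * x a = t * (t * x a) by rewrite -tts mulrA.
by rewrite -mulrA ler_pM2l //; lra.
Qed.

Lemma weight1 a w : adj w a -> kappa1 s * x a <= t * x w.
Proof.
move=> wa; rewrite /kappa1 -[s + 1]subr0; apply: (weight_step (l := [::])) => //.
  by rewrite big_nil mul0r mulr0.
by move: (s1); lra.
Qed.

Lemma weight2 a w u : adj w a -> adj w u -> u != a -> kappa2 s * x a <= t * x w.
Proof.
move=> wa wu ua; rewrite (kappa2E t1 tts).
have [_ k1 _] := kappa_lt t1 tts.
apply: (weight_step (l := [:: u])) => //=.
- by rewrite inE eq_sym ua.
- by rewrite wu.
- by rewrite big_seq1 weight1 // adj_sym.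
- lra.
Qed.

Lemma weight3 a w u z : adj w a -> adj w u -> u != a -> adj u z -> z != w ->
  kappa3 s * x a <= t * x w.
Proof.
move=> wa wu ua uz zw; rewrite (kappa3E t1 tts).
have [_ _ k2] := kappa_lt t1 tts.
apply: (weight_step (l := [:: u])) => //=.
- by rewrite inE eq_sym ua.
- by rewrite wu.
- by rewrite big_seq1; apply: weight2 uz _ => //; rewrite adj_sym.
- lra.
Qed.

Lemma weight_fork a w u u' : adj w a -> adj w u -> adj w u' -> uniq [:: a; u; u'] ->
  2 * kappa1 s < s + 1 -> s / (s + 1 - 2 * kappa1 s) * x a <= t * x w.
Proof.
move=> wa wu wu' un k1; apply: (weight_step (l := [:: u; u'])) => //=.
  by rewrite wu wu'.
rewrite big_cons big_seq1.
have := weight1 (_ : adj u w); have := weight1 (_ : adj u' w).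
rewrite ![adj _ w]adj_sym => /(_ wu') h1 /(_ wu) h2; lra.
Qed.

(* Shifted by one, to fit the boundary conditions of [supersolution]. *)
Definition path_values (v : nat -> G) (i : nat) : R :=
  if (0 < i <= D.+1)%N then x (v i.-1) else 0.

Section PathLoads.
Variable v : nat -> G.
Hypothesis gv : geodesic D v.

Let X := path_values v.
Let M := D.+1.

Lemma path_valuesE i : (i <= D)%N -> X i.+1 = x (v i).
Proof. by move=> iD; rewrite /X /path_values (_ : 0 < i.+1 <= D.+1)%N. Qed.

Lemma load_outer i l k : (i <= D)%N -> uniq l -> all (adj (v i)) l ->
  all (outer D v) l -> k * x (v i) <= t * (\sum_(b <- l) x b) -> load t k X i.+1.
Proof.
move=> iD ul al ol hk; apply/(loadE X tts); rewrite (path_valuesE iD) /=.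
have vl j : (j <= D)%N -> v j \notin l.
  by move=> jD; apply/negP => /(allP ol) /outerP /(_ _ jD); rewrite eqxx.
(* All known neighbours of [v i]. A path neighbour missing at an end is matched by the value 0 of
   [X]. *)
pose l' := (if (0 < i)%N then [:: v i.-1] else [::]) ++
  (if (i < D)%N then [:: v i.+1] else [::]) ++ l.
have E : \sum_(b <- l') x b = X i + X i.+2 + \sum_(b <- l) x b.
  rewrite /l' !big_cat /= addrA; congr (_ + _ + _).
    case: ifP => i0; last by rewrite big_nil /X /path_values i0.
    by rewrite big_seq1 -path_valuesE ?prednK //; nlia.
  case: ifP => i0; first by rewrite big_seq1 path_valuesE.
  by rewrite big_nil /X /path_values (_ : (i.+1 < D.+1) = false)%N ?andbF.
have ul' : uniq l'.
  rewrite /l' cat_uniq; apply/and3P; split; first by case: ifP.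
    apply/hasPn => b; case: (boolP (0 < i)%N) => i0 bl //.
    rewrite /= inE; apply: contraL bl => /eqP ->; rewrite mem_cat.
    rewrite negb_or vl ?andbT; last by nlia.
    case: ifP => iD' //; rewrite inE; apply/negP => /eqP.
    by move/(geodesic_inj gv) => h; have := h (ltac:(nlia)) (ltac:(nlia)); nlia.
  by case: ifP => //= i0; rewrite ul vl.
have al' : all (adj (v i)) l'.
  rewrite /l' !all_cat al andbT; apply/andP; split; case: ifP => //= i0; rewrite andbT.
    by rewrite (geodesic_adj gv) ?prednK //; nlia.
  by rewrite (geodesic_adj gv) // eqxx orbT.
have := super_seq ul' al'; rewrite E; lra.
Qed.

Lemma path_supersolution : supersolution t M X.
Proof.
split=> [||i iM|i iM].
- by rewrite /X /path_values.
- by rewrite /X /path_values ltnn andbF.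
- by rewrite /X /path_values iM.
- have -> : i = i.-1.+1 by nlia.
  by apply: (load_outer (l := [::])) => //; [nlia|rewrite big_nil mulr0 mul0r].
Qed.

Definition hot i := [exists w, outer D v w && adj (v i) w].

Lemma hotP i : reflect (exists2 w, outer D v w & adj (v i) w) (hot i).
Proof.
by apply: (iffP existsP) => -[w]; [move=> /andP[]; exists w|move=> ow vw; exists w; rewrite ow].
Qed.

Lemma hot_load_path i : (i <= D)%N -> hot i -> load t (kappa1 s) X i.+1.
Proof.
move=> iD /hotP[w ow vw]; apply: (load_outer (l := [:: w])) => //=; rewrite ?vw ?ow //.
by rewrite big_seq1 weight1 // adj_sym.
Qed.

Lemma heavy_load i w u : (i <= D)%N -> outer D v w -> adj (v i) w ->
  adj w u -> u != v i -> load t (kappa2 s) X i.+1.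
Proof.
move=> iD ow vw wu uv; apply: (load_outer (l := [:: w])) => //=; rewrite ?vw ?ow //.
by rewrite big_seq1 (weight2 _ wu) // adj_sym.
Qed.

End PathLoads.

Hypothesis mu_bounds : 0 < mu s <= 1 / 1000.
Hypothesis D60 : (60 <= D)%N.
Hypothesis diam : forall a b : G, exists2 l, (l <= D)%N & has_walk a b l.

Section AlongGeodesic.
Variable v : nat -> G.
Hypothesis gv : geodesic D v.
Hypothesis outer5 : #|outer D v| = 5%N.

Let X := path_values v.
Let M := D.+1.
Let Xs : supersolution t M X := path_supersolution gv.

Lemma hot_gap_path i j : (0 < i < j)%N -> (j < D)%N -> hot v i -> hot v j -> (9 < j - i)%N.
Proof.
move=> ij jD hi hj; rewrite -subSS.
apply: (hot_gap t1 tts Xs mu_bounds); rewrite ?/M; try nlia.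
  by apply: (hot_load_path gv) => //; nlia.
by apply: (hot_load_path gv) => //; nlia.
Qed.

(** The form in which [hot_gap_path] is used: a short walk off the path cannot join two different
    attachment vertices. *)
Lemma hot_eq i j l : (0 < i < D)%N -> (0 < j < D)%N -> hot v i -> hot v j ->
  has_walk (v i) (v j) l -> (l <= 9)%N -> i = j.
Proof.
move=> iD jD hi hj w l9; have [ij|ji|//] := ltngtP i j.
  have := hot_gap_path (ltac:(nlia) : (0 < i < j)%N) (ltac:(nlia)) hi hj.
  have := geodesic_dist gv (ltnW ij) (ltac:(nlia)) w; nlia.
have := hot_gap_path (ltac:(nlia) : (0 < j < i)%N) (ltac:(nlia)) hj hi.
have := geodesic_dist gv (ltnW ji) (ltac:(nlia)) (has_walk_sym w); nlia.
Qed.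

Lemma two_outer_left i w w' : (0 < i)%N -> (i + 11 <= D)%N ->
  outer D v w -> outer D v w' -> adj (v i) w -> adj (v i) w' -> w = w'.
Proof.
move=> i0 iD ow ow' vw vw'; apply/eqP; case: eqVneq => // ww'; exfalso.
have [n1 _ _] := overload_numerics t1 tts mu_bounds.
apply: (overload t1 tts Xs mu_bounds (ltn0Sn i) _ _ _ n1); first by rewrite /M; nlia.
  by apply: (ratio1 t1 tts Xs); rewrite /M; nlia.
apply: (load_outer gv (l := [:: w; w'])) => /=; rewrite ?inE ?ww' ?vw ?vw' ?ow ?ow' //.
  by nlia.
rewrite big_cons big_seq1.
have := weight1 (_ : adj w (v i)); have := weight1 (_ : adj w' (v i)).
by rewrite ![adj _ (v i)]adj_sym => /(_ vw') h1 /(_ vw) h2; lra.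
Qed.

Lemma heavy_left i w u : (i + 11 <= D)%N -> outer D v w -> adj (v i) w ->
  adj w u -> u != v i -> kappa3 s * X i.+1 <= t * X i -> False.
Proof.
move=> iD ow vw wu uv r; have [_ n2 _] := overload_numerics t1 tts mu_bounds.
apply: (overload t1 tts Xs mu_bounds (ltn0Sn i) _ r _ n2); first by rewrite /M; nlia.
by apply: (heavy_load gv _ ow vw wu uv) => //; nlia.
Qed.

Lemma heavy_middle_left i w u : (2 < i)%N -> (i + 11 <= D)%N -> outer D v w ->
  adj (v i) w -> adj w u -> u = v i.
Proof.
move=> i3 iD ow vw wu; apply/eqP; case: eqVneq => // uv; exfalso.
apply: (heavy_left iD ow vw wu uv).
by apply: (ratio3 t1 tts Xs); rewrite /M; nlia.
Qed.

Lemma outer_chain_size u p1 : uniq (u :: p1) -> all (outer D v) (u :: p1) ->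
  (size p1 <= 4)%N.
Proof.
move=> un al; suff : (size (u :: p1) <= 5)%N by [].
rewrite -outer5 -(card_uniqP un).
by apply: subset_leq_card; apply/fintype.subsetP => b /(allP al).
Qed.

(* A geodesic to [v D] gives the way back to the path from any outer vertex. *)
Lemma outer_exit u : outer D v u -> exists p1 j,
  [/\ path (@adj G) u (rcons p1 (v j)), uniq (u :: p1), all (outer D v) (u :: p1),
      (size p1 < j <= D)%N & (size p1 <= 4)%N].
Proof.
move=> ou; have [l lD w] := diam u (v D).
have [p [pp lp un sp]] := has_walk_shorten w.
have [p1 [j [p2 [pE jD op lj [w1 w2]]]]] := first_path_vertex (leqnn D) ou pp lp.
exists p1, j.
have un1 : uniq (u :: p1).
  by move: un; rewrite pE -cat_cons cat_uniq => /and3P[].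
split=> //; last exact: outer_chain_size un1 op.
  by move: pp; rewrite pE cat_path rcons_path /= => /and3P[-> -> _].
(* The walk has length at most [D] and still needs [D - j] steps after [v j], so it reaches [v j]
   within [j] steps. *)
have := geodesic_dist gv jD (leqnn D) w2; move: sp; rewrite pE size_cat /=; nlia.
Qed.

Lemma walk_rcons (u b : G) p : path (@adj G) u (rcons p b) -> has_walk u b (size p).+1.
Proof. by move=> pp; apply/has_walkP; exists (rcons p b); rewrite last_rcons size_rcons. Qed.

(** An outer neighbour of [v 0] closes a cycle with its way back to some [v j]. At [v j] the left
    side then counts at least [kappa3] and the outer side at least [kappa2], an overload. *)
Lemma v0_not_hot w : outer D v w -> adj (v 0%N) w = false.
Proof.
move=> ow; apply/negP => vw.
have [p1 [j [pp un op /andP[sj jD] s4]]] := outer_exit ow.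
have j6 : (j <= 6)%N.
  have := geodesic_dist gv (leq0n j) jD (has_walk_cat (has_walk1 vw) (walk_rcons pp)).
  nlia.
(* The next vertex after [w] on the way back, possibly [v j] itself. *)
have [b wb b0] : exists2 b, adj w b & b != v 0%N.
  case: p1 pp un op sj {s4} => [|b p1] /=.
    rewrite andbT => wj _ _ j0; exists (v j) => //.
    by apply/eqP => /(geodesic_inj gv jD (leq0n _)); nlia.
  move=> /andP[wb _] _ /and3P[_ ob _] _; exists b => //.
  by rewrite eq_sym; move/outerP: ob; apply.
(* The last outer vertex before [v j], with its predecessor; if the way back has only [w], the
   predecessor is [v 0]. *)
have [u [c [ou uj uc cj]]] : exists u c, [/\ outer D v u, adj (v j) u, adj u c & c != v j].
  case/lastP: p1 pp un op sj {s4} => [|p1 u].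
    rewrite /= andbT => wj _ _ j0; exists w, (v 0%N); split=> //; try by rewrite adj_sym.
    by apply/eqP => /(geodesic_inj gv (leq0n _) jD); nlia.
  rewrite !rcons_path last_rcons -rcons_cons all_rcons => /andP[/andP[_ cu] uj] _.
  move=> /andP[ou op] _; exists u, (last w p1); split=> //; try by rewrite adj_sym.
  have : outer D v (last w p1) by apply: (allP op); exact: mem_last.
  by move/outerP/(_ j jD); rewrite eq_sym.
have [k10 k1s k2s] := kappa_lt t1 tts.
have r1 : kappa3 s * X 2%N <= t * X 1%N.
  rewrite /X !path_valuesE; [|nlia..]; rewrite (kappa3E t1 tts).
  apply: (weight_step (l := [:: w])) => /=.
  - by rewrite (geodesic_adj gv) //; nlia.
  - by rewrite inE andbT; apply/negP => /eqP e; move/outerP/(_ 1 (ltac:(nlia))): ow; rewrite e eqxx.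
  - by rewrite vw.
  - by rewrite big_seq1 (weight2 _ wb b0) // adj_sym.
  - lra.
apply: (heavy_left (ltac:(nlia) : (j + 11 <= D)%N) ou uj uc cj).
(* The left ratio [kappa3] comes from the cycle at the first two positions and from the path alone
   afterwards. *)
have [j1|j1|j3] : [\/ j = 1%N, j = 2%N | (2 < j)%N].
  by case: (ltngtP j 2) => h; [constructor 1; nlia|constructor 3|constructor 2].
- by rewrite j1.
- rewrite j1 (kappa3E t1 tts).
  apply: (ratio_step t1 tts Xs); [by rewrite /M; nlia|lra|].
  apply: le_trans r1; rewrite ler_pM2r; first exact: (kappa2_le t1 tts).
  by rewrite /X path_valuesE; [exact: x0|nlia].
- by apply: (ratio3 t1 tts Xs); rewrite /M; nlia.
Qed.

End AlongGeodesic.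

Section BothEnds.
Variable v : nat -> G.
Hypothesis gv : geodesic D v.
Hypothesis outer5 : #|outer D v| = 5%N.

Let rv i := v (D - i).
Let grv : geodesic D rv := geodesic_rev gv.

Let outer5r : #|outer D rv| = 5%N.
Proof. by rewrite -outer5; apply: eq_card => u; exact: outer_rev. Qed.

Lemma outer_hot_range i w : (i <= D)%N -> outer D v w -> adj (v i) w -> (0 < i < D)%N.
Proof.
move=> iD ow vw; rewrite lt0n ltn_neqAle iD andbT; apply/andP; split.
  by apply/eqP => i0; move: vw; rewrite i0 (v0_not_hot gv outer5 ow).
apply/eqP => iD'; move: vw; rewrite iD'.
have := @v0_not_hot rv grv outer5r w; rewrite outer_rev /rv subn0 => -> //.
Qed.

Lemma hotI i w : outer D v w -> adj (v i) w -> hot v i.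
Proof. by move=> ow vw; apply/hotP; exists w. Qed.

Lemma outer_neq i w : (i <= D)%N -> outer D v w -> v i != w.
Proof. by move=> iD /outerP; exact. Qed.

Lemma unique_outer i w w' : (i <= D)%N -> outer D v w -> outer D v w' ->
  adj (v i) w -> adj (v i) w' -> w = w'.
Proof.
move=> iD ow ow' vw vw'; have r := outer_hot_range iD ow vw.
have [h|h] := leqP (i + 11) D.
  by apply: (two_outer_left gv _ h) => //; nlia.
have e : v i = rv (D - i) by rewrite /rv subKn.
by apply: (@two_outer_left rv grv (D - i)); rewrite ?outer_rev -?e //; nlia.
Qed.

Lemma heavy_middle i w u : (2 < i)%N -> (i + 2 < D)%N -> outer D v w ->
  adj (v i) w -> adj w u -> u = v i.
Proof.
move=> i2 iD ow vw wu; have [h|h] := leqP (i + 11) D.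
  by apply: (heavy_middle_left gv i2 h) wu.
have e : v i = rv (D - i) by rewrite /rv subKn //; nlia.
by rewrite e; apply: (@heavy_middle_left rv grv (D - i)) wu; rewrite ?outer_rev -?e //; nlia.
Qed.

(** If [u] were on the path, [w] would join two attachment vertices at distance 2. *)
Lemma heavy_outer i w u : (i <= D)%N -> outer D v w -> adj (v i) w -> adj w u ->
  u != v i -> outer D v u.
Proof.
move=> iD ow vw wu ui; apply: contraT => /outerPn[j jD uE].
have wj : adj (v j) w by rewrite -uE adj_sym.
have e : i = j.
  apply: (hot_eq gv (outer_hot_range iD ow vw) (outer_hot_range jD ow wj)
    (hotI ow vw) (hotI ow wj) (has_walk_cat (has_walk1 vw) (has_walk1 _))) => //.
  by rewrite adj_sym.
by move: ui; rewrite uE e eqxx.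
Qed.

(** The diameter excludes this case: the way back from [u] must reach some [v j] in at most [j]
    steps, and [hot_eq] forces [j = 1]. So [u] is adjacent to [v 1], as is [w], against
    [unique_outer]. *)
Lemma v1_not_heavy w u : outer D v w -> adj (v 1%N) w -> adj w u -> u = v 1%N.
Proof.
move=> ow vw wu; apply/eqP; case: eqVneq => // u1; exfalso.
have ou := heavy_outer (ltac:(nlia) : (1 <= D)%N) ow vw wu u1.
have [p1 [j [pp un op /andP[sj jD] s4]]] := outer_exit gv outer5 ou.
have [b ob bj] : exists2 b, outer D v b & adj (v j) b.
  exists (last u p1); first by apply: (allP op); exact: mem_last.
  by move: pp; rewrite rcons_path adj_sym => /andP[].
have e : 1%N = j.
  apply: (hot_eq gv (outer_hot_range _ ow vw) (outer_hot_range jD ob bj)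
    (hotI ow vw) (hotI ob bj)
    (has_walk_cat (has_walk_cat (has_walk1 vw) (has_walk1 wu)) (walk_rcons pp))); nlia.
have p0 : p1 = [::] by apply: size0nil; nlia.
move: pp; rewrite p0 -e /= andbT adj_sym => vu.
have uw := unique_outer (ltac:(nlia) : (1 <= D)%N) ow ou vw vu.
by move: wu; rewrite uw adj_irr.
Qed.

Lemma heavy_two_unique w u u' : outer D v w -> adj (v 2%N) w -> adj w u ->
  adj w u' -> u != v 2%N -> u' != v 2%N -> u = u'.
Proof.
move=> ow vw wu wu' u2 u2'; apply/eqP; case: eqVneq => // uu; exfalso.
have [_ _ n3] := overload_numerics t1 tts mu_bounds.
have Xs := path_supersolution gv.
apply: (overload t1 tts Xs mu_bounds (ltn0Sn 2) _ _ _ n3); first by nlia.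
  by apply: (ratio1 t1 tts Xs); nlia.
apply: (load_outer gv (l := [:: w])) => //=; rewrite ?vw ?ow //; first by nlia.
rewrite big_seq1; apply: (weight_fork (u := u) (u' := u')) => //.
- by rewrite adj_sym.
- by rewrite /= !inE negb_or (eq_sym (v 2%N)) u2 (eq_sym (v 2%N)) u2' uu.
- by rewrite /kappa1 mulrA ltr_pdivrMr; move: (s1); nra.
Qed.

Lemma heavy_two_end w u z : outer D v w -> adj (v 2%N) w -> adj w u ->
  u != v 2%N -> adj u z -> z = w.
Proof.
move=> ow vw wu u2 uz; apply/eqP; case: eqVneq => // zw; exfalso.
have [_ n2 _] := overload_numerics t1 tts mu_bounds.
have Xs := path_supersolution gv.
apply: (overload t1 tts Xs mu_bounds (ltn0Sn 2) _ _ _ (_ : _ <= kappa2 s + kappa3 s)).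
- by nlia.
- by apply: (ratio2 t1 tts Xs); nlia.
- apply: (load_outer gv (l := [:: w])) => //=; rewrite ?vw ?ow //; first by nlia.
  by rewrite big_seq1; apply: (weight3 _ wu u2 uz zw); rewrite adj_sym.
- by rewrite [kappa2 s + _]addrC.
Qed.

End BothEnds.

(** * Classification and counting of the five outer vertices *)

Section Classification.
Variable v : nat -> G.
Hypothesis gv : geodesic D v.
Hypothesis outer5 : #|outer D v| = 5%N.

Let rv i := v (D - i).
Let grv : geodesic D rv := geodesic_rev gv.

Let outer5r : #|outer D rv| = 5%N.
Proof. by rewrite -outer5; apply: eq_card => u; exact: outer_rev. Qed.

Lemma heavy_position i w u : (i <= D)%N -> outer D v w -> adj (v i) w ->
  adj w u -> u != v i -> i = 2%N \/ i = (D - 2)%N.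
Proof.
move=> iD ow vw wu ui; have r := outer_hot_range gv outer5 iD ow vw.
have [//|[i1|[i1|[i2 i2']]]] : (i = 2%N \/ i = (D - 2)%N) \/
    (i = 1%N \/ i = (D - 1)%N \/ (2 < i)%N /\ (i + 2 < D)%N) by nlia.
- by subst i; move: ui; rewrite (v1_not_heavy gv outer5 ow vw wu) eqxx.
- have e : v i = rv 1%N by rewrite /rv i1.
  move: ui; rewrite e (@v1_not_heavy rv grv outer5r w u) ?eqxx ?outer_rev -?e //.
- by move: ui; rewrite (heavy_middle gv i2 i2' ow vw wu) eqxx.
Qed.

Lemma heavy_unique i w u u' : (i <= D)%N -> outer D v w -> adj (v i) w -> adj w u ->
  adj w u' -> u != v i -> u' != v i -> u = u'.
Proof.
move=> iD ow vw wu wu' ui ui'; case: (heavy_position iD ow vw wu ui) => e.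
  by subst i; exact: (heavy_two_unique gv ow vw wu wu').
have eD : v i = rv 2%N by rewrite /rv e.
by rewrite eD in vw ui ui'; apply: (heavy_two_unique grv _ vw wu wu' ui ui'); rewrite outer_rev.
Qed.

Lemma heavy_end i w u z : (i <= D)%N -> outer D v w -> adj (v i) w -> adj w u ->
  u != v i -> adj u z -> z = w.
Proof.
move=> iD ow vw wu ui uz; case: (heavy_position iD ow vw wu ui) => e.
  by subst i; exact: (heavy_two_end gv ow vw wu ui uz).
have eD : v i = rv 2%N by rewrite /rv e.
by rewrite eD in vw ui; apply: (heavy_two_end grv _ vw wu ui uz); rewrite outer_rev.
Qed.

(** A way back with three or more outer vertices would continue a pendant path of length 2, which
    [heavy_end] forbids. *)
Lemma outer_covered z : outer D v z ->
  (exists2 i, (0 < i < D)%N & adj (v i) z) \/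
  (exists i w, [/\ (0 < i < D)%N, outer D v w, adj (v i) w, adj w z & z != v i]).
Proof.
move=> oz; have [p1 [j [pp un op /andP[sj jD] s4]]] := outer_exit gv outer5 oz.
have zj : z != v j by rewrite eq_sym (outer_neq jD oz).
case/lastP: p1 pp un op {sj s4} => [|p w].
  rewrite /= andbT adj_sym => zv _ _; left; exists j => //.
  exact: (outer_hot_range gv outer5 jD oz zv).
rewrite !rcons_path last_rcons -rcons_cons all_rcons rcons_uniq.
rewrite adj_sym [adj _ (v j)]adj_sym.
move=> /andP[/andP[pz pw] jw] /andP[wn _] /andP[ow op].
have r := outer_hot_range gv outer5 jD ow jw.
case/lastP: p pz pw wn op => [|p b] /=.
  by move=> _ wz _ _; right; exists j, w.
rewrite rcons_path last_rcons => /andP[_ cb] wb wn op; exfalso.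
have ob : outer D v b by move: op; rewrite all_rcons => /and3P[].
have bj : b != v j by rewrite eq_sym (outer_neq jD ob).
move: wn; rewrite adj_sym in cb.
rewrite -(heavy_end jD ow jw wb bj cb) -rcons_cons mem_rcons inE mem_last orbT //.
Qed.

Definition second i u : bool :=
  [exists w, [&& outer D v w, adj (v i) w, adj w u & u != v i]].

Lemma secondP i u : reflect
  (exists w, [/\ outer D v w, adj (v i) w, adj w u & u != v i]) (second i u).
Proof. by apply: (iffP existsP) => -[w /and4P]; exists w => //; apply/and4P. Qed.

Definition heavy i : bool := [exists u, second i u].

Lemma heavy_hot i : heavy i -> hot v i.
Proof. by move=> /existsP[u /secondP[w [ow vw _ _]]]; exact: hotI ow vw. Qed.

Hypothesis no_four_hot : s ^+ (D - 2) * ((mu s / s) ^+ 5 * s) < 1.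

(** The last premise supplies the small ratio at [i1]: either a heavy end is there, with
    [omega s <= mu s / s], or an earlier attachment makes [bwd] positive. *)
Lemma four_hot_path i1 i2 i3 i4 : (0 < i1 < i2)%N -> (i2 < i3 < i4)%N -> (i4 < D)%N ->
  hot v i1 -> hot v i2 -> hot v i3 -> hot v i4 ->
  heavy 2 /\ i1 = 2%N \/ (exists2 i0, (0 < i0 < i1)%N & hot v i0) -> False.
Proof.
move=> i12 i34 iD h1 h2 h3 h4 hf.
have Xs := path_supersolution gv.
have l1 := hot_load_path gv (ltac:(nlia) : (i1 <= D)%N) h1.
have l2 := hot_load_path gv (ltac:(nlia) : (i2 <= D)%N) h2.
have l3 := hot_load_path gv (ltac:(nlia) : (i3 <= D)%N) h3.
have l4 := hot_load_path gv (ltac:(nlia) : (i4 <= D)%N) h4.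
have f1 : fwd t (path_values v) i1.+1 <= mu s / s * (t * bwd t (path_values v) i1.+2).
  case: hf => [[/existsP[u /secondP[w [ow vw wu u2]]] i2E]|[i0 i01 h0]]; last first.
    have l0 := hot_load_path gv (ltac:(nlia) : (i0 <= D)%N) h0.
    apply: (interior_fwd_le t1 tts Xs mu_bounds _ l1); first by nlia.
    by apply/ltW/(bwd_gt0_right t1 tts Xs _ _ l0); nlia.
  subst i1; have k2 := heavy_load gv (ltac:(nlia) : (2 <= D)%N) ow vw wu u2.
  have /andP[w0 w1] := omega_le t1 tts mu_bounds.
  have V : 0 < bwd t (path_values v) 4.
    by apply: (bwd_gt0_right t1 tts Xs _ _ l1); nlia.
  have := heavy_end_fwd_le t1 tts Xs mu_bounds (ltac:(nlia)) k2.
  by move=> h; apply: le_trans h _; rewrite ler_wpM2r // mulr_ge0 // ltW.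
have := four_hot t1 tts Xs mu_bounds (ltac:(nlia) : (1 < i1.+1 < i2.+1)%N)
  (ltac:(nlia) : (i2.+1 < i3.+1 < i4.+1)%N) (ltac:(nlia) : (i4.+1 < D.+1)%N) l1 l2 l3 l4 f1.
apply/negP; rewrite -ltNge; apply: le_lt_trans no_four_hot.
have /andP[m0 _] := mu_bounds.
rewrite ler_wpM2r //; last by rewrite ler_weXn2l ?ltW //; nlia.
by rewrite mulr_ge0 ?exprn_ge0 ?divr_ge0 ?ltW // (lt_trans ltr01).
Qed.

Definition hots := [seq i <- iota 1 D.-1 | hot v i].

Lemma mem_hots i : (i \in hots) = (0 < i < D)%N && hot v i.
Proof. by rewrite mem_filter mem_iota andbC; congr (_ && _); nlia. Qed.

Lemma sorted_hots : sorted ltn hots.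
Proof. by apply: sorted_filter; [exact: ltn_trans|exact: iota_ltn_sorted]. Qed.

(** Each attachment vertex has one outer neighbour, and only the two possible heavy positions carry
    one vertex more. These must account for all five. *)
Lemma outer_count : (5 <= size hots + (heavy 2 + heavy (D - 2)))%N.
Proof.
(* By uniqueness these selections reach every outer vertex; [v 0] is only a dummy value. *)
pose wsel i := odflt (v 0%N) [pick w | outer D v w && adj (v i) w].
pose usel i := odflt (v 0%N) [pick u | second i u].
have wE i w : (i <= D)%N -> outer D v w -> adj (v i) w -> wsel i = w.
  move=> iD ow vw; rewrite /wsel; case: pickP => [w' /andP[ow' vw']|/(_ w)].
    exact: (unique_outer gv outer5 iD ow' ow vw' vw).
  by rewrite ow vw.
have uE i u : (i <= D)%N -> second i u -> usel i = u.
  move=> iD su; rewrite /usel; case: pickP => [u' su'|/(_ u)]; last by rewrite su.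
  case/secondP: su => w [ow vw wu ui]; case/secondP: su' => w' [ow' vw' wu' ui'].
  rewrite (unique_outer gv outer5 iD ow' ow vw' vw) in wu'.
  exact: (heavy_unique iD ow vw wu' wu ui' ui).
pose hvs := [seq i <- [:: 2%N; (D - 2)%N] | heavy i].
have -> : (heavy 2 + heavy (D - 2) = size hvs)%N.
  by rewrite /hvs size_filter /= addn0.
pose L := map wsel hots ++ map usel hvs.
have -> : (size hots + size hvs = size L)%N by rewrite size_cat !size_map.
rewrite -outer5 cardE; apply: uniq_leq_size; first exact: enum_uniq.
move=> z; rewrite mem_enum => oz; rewrite mem_cat; apply/orP.
have [[i iD vz]|[i [w [iD ow vw wz zi]]]] := outer_covered oz.
  left; apply/mapP; exists i; last by rewrite (wE i z) //; nlia.
  by rewrite mem_hots iD (hotI oz vz).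
right; have iD' : (i <= D)%N by nlia.
have sz : second i z by apply/secondP; exists w.
apply/mapP; exists i; last by rewrite (uE i z).
rewrite mem_filter; apply/andP; split; first by apply/existsP; exists z.
by rewrite !inE; case: (heavy_position iD' ow vw wz zi) => ->; rewrite eqxx ?orbT.
Qed.

Lemma size_hots_le4 : (size hots <= 4)%N.
Proof.
rewrite leqNgt; apply/negP; have := sorted_hots.
have hD i : i \in hots -> (0 < i < D)%N /\ hot v i by rewrite mem_hots => /andP[].
case: hots hD => [//|z [//|a [//|b [//|c [//|d l]]]]] hD /= /and5P[za ab bc cd _] _.
have [z0 hz] := hD z (ltac:(rewrite !inE eqxx; done)).
have [a0 ha] := hD a (ltac:(rewrite !inE eqxx ?orbT; done)).
have [b0 hb] := hD b (ltac:(rewrite !inE eqxx ?orbT; done)).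
have [c0 hc] := hD c (ltac:(rewrite !inE eqxx ?orbT; done)).
have [d0 hd] := hD d (ltac:(rewrite !inE eqxx ?orbT; done)).
apply: (four_hot_path _ _ _ ha hb hc hd); [nlia..|].
by right; exists z => //; nlia.
Qed.

Lemma heavy_hots_ge i : heavy 2 -> i \in hots -> (2 <= i)%N.
Proof.
move=> /heavy_hot h2; rewrite mem_hots => /andP[iD hi]; rewrite leqNgt; apply/negP => i2.
have := hot_gap_path gv (ltac:(nlia) : (0 < i < 2)%N) (ltac:(nlia)) hi h2; nlia.
Qed.

Lemma heavy_hots_le i : heavy (D - 2) -> i \in hots -> (i <= D - 2)%N.
Proof.
move=> /heavy_hot h2; rewrite mem_hots => /andP[iD hi]; rewrite leqNgt; apply/negP => i2.
have := hot_gap_path gv (ltac:(nlia) : (0 < D - 2 < i)%N) (ltac:(nlia)) h2 hi; nlia.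
Qed.

(** A heavy position 2 is the first attachment vertex, so four of them already meet the premises of
    [four_hot_path]. *)
Lemma heavy_size_hots : heavy 2 -> (size hots <= 3)%N.
Proof.
move=> hv; have m2 : 2%N \in hots by rewrite mem_hots (heavy_hot hv) andbT; nlia.
rewrite leqNgt; apply/negP; have := sorted_hots; have := heavy_hots_ge hv.
have hD i : i \in hots -> (0 < i < D)%N /\ hot v i by rewrite mem_hots => /andP[].
case: hots m2 hD => [//|a [//|b [//|c [//|d l]]]] m2 hD ge2 srt _.
have := srt; rewrite /= => /and4P[ab bc cd _].
have [a0 ha] := hD a (ltac:(rewrite !inE eqxx; done)).
have [b0 hb] := hD b (ltac:(rewrite !inE eqxx ?orbT; done)).
have [c0 hc] := hD c (ltac:(rewrite !inE eqxx ?orbT; done)).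
have [d0 hd] := hD d (ltac:(rewrite !inE eqxx ?orbT; done)).
have a2 : (2 <= a)%N by apply: ge2; rewrite inE eqxx.
move: m2; rewrite inE => /orP[/eqP e|l2].
  by apply: (four_hot_path _ _ _ ha hb hc hd); [nlia..|left].
have /allP /(_ _ l2) := order_path_min ltn_trans srt.
by rewrite /= ltnNge a2.
Qed.

End Classification.

(** * Exactly three attachment vertices, and the isomorphism with a tree *)

Section ThreeHot.
Variable v : nat -> G.
Hypothesis gv : geodesic D v.
Hypothesis outer5 : #|outer D v| = 5%N.
Hypothesis no_four_hot : s ^+ (D - 2) * ((mu s / s) ^+ 5 * s) < 1.

Let rv i := v (D - i).
Let grv : geodesic D rv := geodesic_rev gv.

Let outer5r : #|outer D rv| = 5%N.
Proof. by rewrite -outer5; apply: eq_card => u; exact: outer_rev. Qed.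

Lemma hot_rev i : (i <= D)%N -> hot rv (D - i) = hot v i.
Proof.
by move=> iD; apply: eq_existsb => w; rewrite outer_rev /rv subKn.
Qed.

Lemma heavy_rev i : (i <= D)%N -> heavy rv (D - i) = heavy v i.
Proof.
move=> iD; apply: eq_existsb => u; apply: eq_existsb => w.
by rewrite outer_rev /rv subKn.
Qed.

Lemma size_hots_rev : size (hots rv) = size (hots v).
Proof.
rewrite -(size_map (fun i => D - i)%N (hots v)); apply: perm_size; apply: uniq_perm.
- exact: (sorted_uniq ltn_trans ltnn (sorted_hots rv)).
- rewrite map_inj_in_uniq; first exact: (sorted_uniq ltn_trans ltnn (sorted_hots v)).
  by move=> i j; rewrite !mem_hots => /andP[iD _] /andP[jD _]; nlia.
move=> i; apply/idP/mapP => [|[j]]; rewrite !mem_hots => /andP[iD hi].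
  exists (D - i)%N; last by nlia.
  by rewrite mem_hots -hot_rev ?subKn ?hi ?andbT //; nlia.
by move=> ->; rewrite hot_rev ?hi ?andbT //; nlia.
Qed.

(** There are at most four attachment vertices, and at most three if an end is heavy. A total of
    five outer vertices is reached only with three of them and both ends heavy. *)
Lemma three_hot : exists h, [/\ (2 < h < D - 2)%N, hot v h, heavy v 2, heavy v (D - 2) &
  forall i, (0 < i < D)%N -> hot v i -> [\/ i = 2%N, i = h | i = (D - 2)%N]].
Proof.
have cnt := outer_count gv outer5.
have s4 := size_hots_le4 gv no_four_hot.
have [hl hr] : heavy v 2 /\ heavy v (D - 2).
  have hsl := heavy_size_hots gv no_four_hot.
  have hsr := heavy_size_hots grv no_four_hot.
  rewrite size_hots_rev in hsr.
  have e := heavy_rev (ltac:(nlia) : (D - 2 <= D)%N).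
  rewrite subKn in e; last by nlia.
  rewrite e in hsr; move: cnt s4 hsl hsr.
  case: (heavy v 2) => /=; case: (heavy v (D - 2)) => //= cnt s4 hsl hsr; exfalso.
  - by have := hsl isT; nlia.
  - by have := hsr isT; nlia.
  - by nlia.
have s3 := heavy_size_hots gv no_four_hot hl.
rewrite hl hr in cnt.
have m2 : 2%N \in hots v by rewrite mem_hots (heavy_hot hl) andbT; nlia.
have mD : (D - 2)%N \in hots v by rewrite mem_hots (heavy_hot hr) andbT; nlia.
have := sorted_hots v; have := heavy_hots_ge gv hl; have := heavy_hots_le gv hr.
have mh i : (i \in hots v) = (0 < i < D)%N && hot v i by exact: mem_hots.
case: (hots v) s3 cnt m2 mD mh => [|a [|b [|c [|d l]]]] //= _ _ m2 mD mh le ge /and3P[ab bc _].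
have a2 : (2 <= a)%N by apply: ge; rewrite inE eqxx.
have cD : (c <= D - 2)%N by apply: le; rewrite !inE eqxx !orbT.
have aE : a = 2%N by move: m2; rewrite !inE; nlia.
have cE : c = (D - 2)%N by move: mD; rewrite !inE; nlia.
exists b; split=> //; first by nlia.
  by have := mh b; rewrite !inE eqxx orbT => /esym /andP[].
move=> i iD hi; have := mh i; rewrite iD hi !inE aE cE.
by case/or3P => /eqP; [constructor 1|constructor 2|constructor 3].
Qed.

Lemma outer_neighbor i p w : (i <= D)%N -> (p <= D)%N -> outer D v w ->
  adj (v p) w -> adj (v i) w = (i == p).
Proof.
move=> iD pD ow vw; apply/idP/eqP => [iw|-> //].
have ri := outer_hot_range gv outer5 iD ow iw.
have rp := outer_hot_range gv outer5 pD ow vw.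
rewrite adj_sym in vw; have w2 := has_walk_cat (has_walk1 iw) (has_walk1 vw).
by apply: (hot_eq gv ri rp (hotI ow iw) (hotI ow _) w2) => //; rewrite adj_sym.
Qed.

Lemma second_outer p u : (p <= D)%N -> second v p u -> outer D v u.
Proof. by move=> pD /secondP[w [ow vw wu up]]; exact: (heavy_outer gv outer5 pD ow vw wu up). Qed.

Lemma second_neighbor i p u : (i <= D)%N -> (p <= D)%N -> second v p u ->
  adj (v i) u = false.
Proof.
move=> iD pD su; have ou := second_outer pD su.
case/secondP: su => w [ow vw wu up]; apply/negP => iu.
have uv : adj u (v i) by rewrite adj_sym.
have ri := outer_hot_range gv outer5 iD ou iu.
have rp := outer_hot_range gv outer5 pD ow vw.
have e := hot_eq gv rp ri (hotI ow vw) (hotI ou iu) (has_walk_cat (has_walk_cat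
  (has_walk1 vw) (has_walk1 wu)) (has_walk1 uv)) isT.
subst i; have e := unique_outer gv outer5 pD ow ou vw iu.
by move: wu; rewrite e adj_irr.
Qed.

(** Attachments at different vertices are neither equal nor adjacent, since either would give a walk
    of length at most 9 between them. *)
Lemma outer_far p q z z' l l' : (0 < p < D)%N -> (0 < q < D)%N -> hot v p -> hot v q ->
  p != q -> has_walk (v p) z l -> has_walk (v q) z' l' -> (l + l' <= 8)%N ->
  z != z' /\ adj z z' = false.
Proof.
move=> rp rq hp hq pq wz wz' ll; split.
  apply/eqP => e; subst z'; move/eqP: pq; apply.
  by apply: (hot_eq gv rp rq hp hq (has_walk_cat wz (has_walk_sym wz'))); nlia.
apply/negP => zz; move/eqP: pq; apply.
apply: (hot_eq gv rp rq hp hq (has_walk_cat (has_walk_cat wz (has_walk1 zz)) (has_walk_sym wz'))).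
nlia.
Qed.

(** The positions and kinds of the attachments determine all adjacencies, so the evident map from
    the tree preserves them. It is injective, and the five outer vertices make the cardinalities
    agree. *)
Lemma tree_isomorphic h k1 k2 : h = (k1 + 3)%N -> D = (k1 + k2 + 6)%N ->
  hot v h -> heavy v 2 -> heavy v (D - 2) -> isomorphic (tree_T [:: k1; k2]) G.
Proof.
move=> hE DE hh h2 hD; set ks := [:: k1; k2].
pose P := branch_pos ks.
have [P0 [P1 P2]] : P 0%N = 2%N /\ P 1%N = h /\ P 2%N = (D - 2)%N by rewrite /P /=; nlia.
have nD : (tree_n ks - tree_e ks = D)%N by rewrite /tree_n /tree_e /=; nlia.
have PD i : (i < 3)%N -> (0 < P i < D)%N /\ hot v (P i).
  case: i => [|[|[|//]]] _; rewrite ?P0 ?P1 ?P2; split; try nlia => //.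
  - exact: heavy_hot.
  - exact: heavy_hot.
have Pinj i j : (i < 3)%N -> (j < 3)%N -> P i = P j -> i = j.
  by case: i => [|[|[|//]]] _; case: j => [|[|[|//]]] _; rewrite ?P0 ?P1 ?P2; nlia.
have exW i : exists w, (i < 3)%N -> outer D v w /\ adj (v (P i)) w.
  case: (ltnP i 3) => [i3|]; last by exists (v 0%N).
  by have [_ /hotP[w ow vw]] := PD i i3; exists w.
have [W WE] := boolp.choice exW.
pose Q (b : bool) := if b then 2%N else 0%N.
have Q3 b : (Q b < 3)%N by case: b.
have exU b : exists u, second v (P (Q b)) u.
  by case: b; rewrite /Q ?P0 ?P2; apply/existsP.
have [U UE] := boolp.choice exU.
have UW b : adj (W (Q b)) (U b).
  have [ow vw] := WE _ (Q3 b); have /secondP[w [ow' vw' wu _]] := UE b.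
  have [rP _] := PD _ (Q3 b).
  by rewrite (unique_outer gv outer5 _ ow ow' vw vw') //; nlia.
have wW i : (i < 3)%N -> has_walk (v (P i)) (W i) 1 by move=> /WE[_ /has_walk1].
have wU b : has_walk (v (P (Q b))) (U b) 2.
  by apply: (has_walk_cat (wW _ (Q3 b))); apply: has_walk1.
have vW (i j : nat) : (i <= D)%N -> (j < 3)%N -> adj (v i) (W j) = (i == P j).
  move=> iD j3; have [ow vw] := WE _ j3; have [rP _] := PD _ j3.
  by apply: outer_neighbor => //; nlia.
have vU (i : nat) b : (i <= D)%N -> adj (v i) (U b) = false.
  by move=> iD; have [rP _] := PD _ (Q3 b); apply: second_neighbor (UE b); nlia.
have oU b : outer D v (U b).
  by have [rP _] := PD _ (Q3 b); apply: second_outer (UE b); nlia.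
have vnW (i j : nat) : (i <= D)%N -> (j < 3)%N -> (v i == W j) = false.
  by move=> iD j3; apply/negbTE/outer_neq => //; have [] := WE _ j3.
have vnU (i : nat) b : (i <= D)%N -> (v i == U b) = false.
  by move=> iD; apply/negbTE/outer_neq.
have WW i j : (i < 3)%N -> (j < 3)%N -> i != j -> W i != W j /\ adj (W i) (W j) = false.
  move=> i3 j3 ij; have [ri hi] := PD _ i3; have [rj hj] := PD _ j3.
  apply: (outer_far ri rj hi hj _ (wW i i3) (wW j j3)) => //.
  by apply: contra ij => /eqP /(Pinj _ _ i3 j3) ->.
have WU i b : (i < 3)%N -> i != Q b -> W i != U b /\ adj (W i) (U b) = false.
  move=> i3 ij; have [ri hi] := PD _ i3; have [rj hj] := PD _ (Q3 b).
  apply: (outer_far ri rj hi hj _ (wW i i3) (wU b)) => //.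
  by apply: contra ij => /eqP /(Pinj _ _ i3 (Q3 b)) ->.
have UU b b' : b != b' -> U b != U b' /\ adj (U b) (U b') = false.
  move=> ij; have [ri hi] := PD _ (Q3 b); have [rj hj] := PD _ (Q3 b').
  apply: (outer_far ri rj hi hj _ (wU b) (wU b')) => //.
  by apply: contra ij => /eqP /(Pinj _ _ (Q3 b) (Q3 b')); case: (b) (b') => [] [].
have WnU i b : (i < 3)%N -> W i != U b.
  move=> i3; case: (eqVneq i (Q b)) => [->|/WU[]//].
  by apply/eqP => e; have := UW b; rewrite e adj_irr.
pose F (z : tree_vertex ks) : G := match z with
  | inl (inl a) => v a | inl (inr i) => W i | inr b => U b end.
have aD (a : 'I_(tree_n ks - tree_e ks).+1) : (a <= D)%N by rewrite -nD -ltnS.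
have i3 (i : 'I_(size ks).+1) : (i < 3)%N by exact: ltn_ord.
have Finj : injective F.
  move=> [[a|i]|b] [[a'|i']|b'] /eqP; rewrite /F.
  - by move=> /eqP /(geodesic_inj gv (aD a) (aD a')) e; congr (inl (inl _)); exact: val_inj.
  - by rewrite (vnW _ _ (aD a) (i3 i')).
  - by rewrite (vnU _ _ (aD a)).
  - by rewrite eq_sym (vnW _ _ (aD a') (i3 i)).
  - have [-> //|ii] := eqVneq i i'.
    by have [/negbTE -> _] := WW i i' (i3 i) (i3 i') ii.
  - by rewrite (negbTE (WnU _ _ (i3 i))).
  - by rewrite eq_sym (vnU _ _ (aD a')).
  - by rewrite eq_sym (negbTE (WnU _ _ (i3 i'))).
  - have [-> //|bb] := eqVneq b b'.
    by have [/negbTE -> _] := UU b b' bb.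
have Fadj z z' : adj (F z) (F z') = tree_adj z z'.
  have QE i b : (i == (if b then ord_max else ord0) :> 'I_(size ks).+1) = (i == Q b :> nat).
    by case: b.
  case: z z' => [[a|i]|b] [[a'|i']|b']; rewrite /F /tree_adj /tree_edge ?orbF ?QE.
  - by rewrite (geodesic_adj gv (aD a) (aD a')) orbC.
  - by rewrite (vW _ _ (aD a) (i3 i')).
  - by rewrite (vU _ _ (aD a)).
  - by rewrite adj_sym (vW _ _ (aD a') (i3 i)).
  - have [->|ii] := eqVneq i i'; first by rewrite adj_irr.
    by have [_ ->] := WW i i' (i3 i) (i3 i') ii.
  - have [->|ii] := eqVneq (i : nat) (Q b'); first exact: UW.
    by have [_ ->] := WU i b' (i3 i) ii.
  - by rewrite adj_sym (vU _ _ (aD a')).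
  - rewrite adj_sym; have [->|ii] := eqVneq (i' : nat) (Q b); first exact: UW.
    by have [_ ->] := WU i' b (i3 i') ii.
  - have [->|bb] := eqVneq b b'; first by rewrite adj_irr.
    by have [_ ->] := UU b b' bb.
exists F; split=> //; apply: inj_card_bij Finj _.
rewrite -(card_outer gv) outer5 (card_tree_T ks) /tree_n /tree_e /=; nlia.
Qed.

End ThreeHot.
End Competitor.

(** * The trees with two gaps *)

Section TwoGapTree.
Variables k1 k2 : nat.
Let ks := [:: k1; k2].
Let T := tree_T ks.
Let D := k1 + k2 + 6.

Definition spine (i : nat) : T := inl (inl (inord i)).
Definition leg (i : 'I_3) : T := inl (inr i).
Definition toe (b : bool) : T := inr b.
Definition toe_leg (b : bool) : 'I_3 := if b then ord_max else ord0.

Let P (i : 'I_3) := branch_pos ks i.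

Lemma diam_tree : tree_n ks - tree_e ks = D.
Proof. by rewrite /tree_n /tree_e /D /=; lia. Qed.

Lemma spineK i : i <= D -> (inord i : 'I_(tree_n ks - tree_e ks).+1) = i :> nat.
Proof. by move=> iD; rewrite inordK // diam_tree. Qed.

Lemma spineP (a : 'I_(tree_n ks - tree_e ks).+1) :
  inl (inl a) = spine a /\ a <= D.
Proof. by rewrite /spine inord_val; split=> //; rewrite -diam_tree -ltnS. Qed.

Lemma adj_spine i j : i <= D -> j <= D ->
  @adj T (spine i) (spine j) = (j == i.+1) || (i == j.+1).
Proof. by move=> iD jD; rewrite /= /tree_adj /= !spineK. Qed.

Lemma adj_spine_leg i j : i <= D -> @adj T (spine i) (leg j) = (i == P j).
Proof. by move=> iD; rewrite /= /tree_adj /= spineK // orbF. Qed.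

Lemma adj_spine_toe i b : @adj T (spine i) (toe b) = false.
Proof. by []. Qed.

Lemma adj_leg_leg i j : @adj T (leg i) (leg j) = false.
Proof. by []. Qed.

Lemma adj_leg_toe i b : @adj T (leg i) (toe b) = (i == toe_leg b).
Proof. by rewrite /= /tree_adj /= orbF. Qed.

Lemma adj_toe_toe b c : @adj T (toe b) (toe c) = false.
Proof. by []. Qed.

Lemma leg_pos : [/\ P ord0 = 2, P (inord 1) = k1 + 3 & P ord_max = D - 2].
Proof. by rewrite /P /= inordK // /D /=; split; lia. Qed.

Lemma leg_posP (i : 'I_3) : [\/ i = ord0, i = inord 1 | i = ord_max].
Proof.
case: i => [[|[|[|//]]] ilt]; [constructor 1|constructor 2|constructor 3];
  by apply: val_inj; rewrite /= ?inordK.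
Qed.

(** Projection to the path. It changes by at most one along an edge, which makes the path a
    geodesic. *)
Definition foot (z : T) : nat := match z with
  | inl (inl a) => a | inl (inr i) => P i | inr b => P (toe_leg b) end.

Definition height (z : T) : nat := match z with
  | inl (inl _) => 0 | inl (inr _) => 1 | inr _ => 2 end.

Lemma spine_geodesic : geodesic D spine.
Proof.
split=> [i iD|l w]; first by rewrite adj_spine ?eqxx //; exact: ltnW.
have lip a b : @adj T a b -> foot b <= foot a + 1.
  have e (u z : T) : tree_edge u z -> foot z <= foot u + 1 /\ foot u <= foot z + 1.
    case: u z => [[a'|i]|c] [[b'|j]|c'] //= /eqP; first by move=> ->; lia.
      by move=> ->; rewrite -/(P j); lia.
    by move=> ->; rewrite /toe_leg; lia.
  by rewrite /= /tree_adj => /orP[/e[]|/e[]].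
by have := has_walk_lipschitz lip w; rewrite /= !spineK.
Qed.

Lemma spine_walk z : has_walk (spine (foot z)) z (height z).
Proof.
have legw i : has_walk (spine (P i)) (leg i) 1.
  apply: has_walk1; rewrite adj_spine_leg ?eqxx //.
  by have [p0 p1 p2] := leg_pos; case: (leg_posP i) => ->; rewrite ?p0 ?p1 ?p2 /D; lia.
case: z => [[a|i]|b] /=.
- by have [-> _] := spineP a; exact: has_walk0.
- exact: legw.
- apply: (has_walk_cat (a := 1) (b := 1) (legw _)); apply: has_walk1.
  by rewrite -[inr b]/(toe b) adj_leg_toe.
Qed.

(** No branch is longer than the shorter part of the path at its foot, so detours through branches
    stay within the diameter. *)
Lemma height_foot z : height z <= foot z /\ height z + foot z <= D.
Proof.
have [p0 p1 p2] := leg_pos; have h1 : k1 + 3 <= D - 2 by rewrite /D; lia.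
have D6 : 6 <= D by rewrite /D; lia.
case: z => [[a|i]|b] /=.
- by have [_] := spineP a; lia.
- by case: (leg_posP i) => ->; rewrite ?p0 ?p1 ?p2; lia.
- by case: b; rewrite /toe_leg ?p0 ?p2; lia.
Qed.

Lemma tree_walk (z z' : T) : exists2 l, l <= D & has_walk z z' l.
Proof.
wlog zz : z z' / foot z <= foot z'.
  move=> h; have [zz|/ltnW zz] := leqP (foot z) (foot z'); first exact: h.
  by have [l lD w] := h _ _ zz; exists l => //; exact: has_walk_sym.
have [h1 h2] := height_foot z; have [h1' h2'] := height_foot z'.
exists (height z + (foot z' - foot z) + height z'); first by lia.
apply: has_walk_cat (spine_walk z'); apply: has_walk_cat.
  exact: has_walk_sym (spine_walk z).
by apply: geodesic_walk spine_geodesic zz _; lia.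
Qed.

Lemma tree_connected : Defs.connected T.
Proof. by move=> z z'; have [l _ /has_walk_connect] := tree_walk z z'. Qed.

Lemma card_tree : #|T| = D + 6.
Proof. by rewrite (card_tree_T ks) /tree_n /tree_e /D /=; lia. Qed.

Lemma tree_in_class : in_class (D + 6) D T.
Proof.
split; [exact: card_tree|exact: tree_connected|].
apply/diameterP; [exact: tree_connected|by rewrite card_tree addnC|].
split; last exact: tree_walk.
by exists (spine 0), (spine D); exact: spine_geodesic.2.
Qed.

Lemma leg_outer i : outer D spine (leg i).
Proof. by apply/outerP. Qed.

Section Eigenvector.
Local Open Scope ring_scope.
Variables (R : realType) (x : T -> R) (t s : R).
Hypotheses (t1 : 1 < t) (tts : t * t = s) (x0 : forall u, 0 < x u).
Hypothesis xeig : forall u, t * nbsum x u = (s + 1) * x u.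

Let s1 : 1 < s. Proof. by move: (t1) => h; rewrite -tts; nra. Qed.

Lemma nbsum_seq (z : T) (l : seq T) :
  uniq l -> (forall u, adj z u = (u \in l)) -> nbsum x z = \sum_(u <- l) x u.
Proof. by move=> ul al; rewrite big_uniq //=; apply: eq_bigl. Qed.

Lemma toe_weight b : t * x (toe b) = kappa1 s * x (leg (toe_leg b)).
Proof.
have := xeig (toe b); rewrite (nbsum_seq (l := [:: leg (toe_leg b)])) //.
  rewrite big_seq1 /kappa1 => e; have s1' := s1.
  have -> : x (leg (toe_leg b)) = (s + 1) * x (toe b) / t.
    by rewrite -e mulrAC mulfV ?mul1r // gt_eqF //; move: (t1); lra.
  by rewrite -tts; field; rewrite !gt_eqF //; move: (t1); nra.
move=> [[a|i]|c]; rewrite inE.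
- by have [-> _] := spineP a; rewrite adj_sym adj_spine_toe.
- by rewrite -[inl (inr i)]/(leg i) adj_sym adj_leg_toe; apply/eqP/eqP => [->|[]].
- by rewrite -[inr c]/(toe c) adj_toe_toe.
Qed.

Lemma leg1_weight : t * x (leg (inord 1)) = kappa1 s * x (spine (k1 + 3)).
Proof.
have [p0 p1 p2] := leg_pos.
have D3 : (k1 + 3 <= D)%N by rewrite /D; lia.
have := xeig (leg (inord 1)); rewrite (nbsum_seq (l := [:: spine (k1 + 3)])) //.
  rewrite big_seq1 /kappa1 => e; have s1' := s1.
  have -> : x (spine (k1 + 3)) = (s + 1) * x (leg (inord 1)) / t.
    by rewrite -e mulrAC mulfV ?mul1r // gt_eqF //; move: (t1); lra.
  by rewrite -tts; field; rewrite !gt_eqF //; move: (t1); nra.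
move=> [[a|i]|c]; rewrite inE.
- have [-> aD] := spineP a; rewrite adj_sym adj_spine_leg // p1.
  apply/eqP/eqP => [->//|[]] /(congr1 val) /=; rewrite !spineK //.
- by rewrite -[inl (inr i)]/(leg i) adj_leg_leg.
- rewrite -[inr c]/(toe c) adj_leg_toe; apply/eqP => /(congr1 val) /=.
  by rewrite inordK // /toe_leg; case: (c).
Qed.

Lemma leg_end_weight b : t * x (leg (toe_leg b)) = kappa2 s * x (spine (P (toe_leg b))).
Proof.
have [p0 p1 p2] := leg_pos.
have PD : (P (toe_leg b) <= D)%N by case: b; rewrite /toe_leg ?p0 ?p2 /D; lia.
have := xeig (leg (toe_leg b)).
rewrite (nbsum_seq (l := [:: spine (P (toe_leg b)); toe b])) //; last first.
  move=> [[a|i]|c]; rewrite !inE.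
  - have [-> aD] := spineP a; rewrite adj_sym adj_spine_leg // orbF.
    apply/eqP/eqP => [->//|[]] /(congr1 val) /=; rewrite !spineK //.
  - by rewrite -[inl (inr i)]/(leg i) adj_leg_leg.
  - rewrite -[inr c]/(toe c) adj_leg_toe /=.
    by apply/eqP/eqP => [|[->] //]; case: (b) (c) => [] [].
rewrite big_cons big_seq1 mulrDr toe_weight => e.
have [k10 k1s _] := kappa_lt t1 tts; have s1' := s1; have t0 : 0 < t by move: (t1); lra.
rewrite (kappa2E t1 tts).
have -> : x (spine (P (toe_leg b))) = (s + 1 - kappa1 s) * x (leg (toe_leg b)) / t.
  have <- : t * x (spine (P (toe_leg b))) = (s + 1 - kappa1 s) * x (leg (toe_leg b)) by lra.
  by rewrite mulrAC mulfV ?mul1r // gt_eqF.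
have k10' : s + 1 - kappa1 s != 0 by rewrite gt_eqF //; lra.
rewrite -{1}tts; move: (kappa1 s) k10' => q q0; field.
by rewrite q0 gt_eqF.
Qed.

Let X := path_values D x spine.

(** The equality counterpart of [load_outer]; [l] lists the legs at the vertex. *)
Lemma spine_exact_load i k (l : seq T) : (i <= D)%N -> uniq l ->
  (forall j, (leg j \in l) = (P j == i)) ->
  (forall u, u \in l -> exists j, u = leg j) ->
  t * (\sum_(u <- l) x u) = k * x (spine i) -> exact_load t s k X i.+1.
Proof.
move=> iD ul lP ll hk.
have Xs j : (j <= D)%N -> X j.+1 = x (spine j) by exact: path_valuesE.
pose l' := (if (0 < i)%N then [:: spine i.-1] else [::]) ++
  (if (i < D)%N then [:: spine i.+1] else [::]) ++ l.
have sl j : spine j \notin l by apply/negP => /ll[].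
have sinj j j' : (j <= D)%N -> (j' <= D)%N -> (spine j == spine j') = (j == j').
  move=> jD j'D; apply/eqP/eqP => [[]|-> //]; move/(congr1 val) => /=.
  by rewrite !spineK.
have E : \sum_(b <- l') x b = X i + X i.+2 + \sum_(b <- l) x b.
  rewrite /l' !big_cat /= addrA; congr (_ + _ + _).
    case: ifP => i0; last by rewrite big_nil /X /path_values i0.
    by rewrite big_seq1 -Xs ?prednK //; lia.
  case: ifP => i0; first by rewrite big_seq1 Xs.
  by rewrite big_nil /X /path_values (_ : (i.+1 < D.+1) = false)%N ?andbF.
have ul' : uniq l'.
  rewrite /l' cat_uniq; apply/and3P; split; first by case: ifP.
    apply/hasPn => b; case: (boolP (0 < i)%N) => i0 bl //.
    rewrite /= inE; apply: contraL bl => /eqP ->; rewrite mem_cat.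
    rewrite negb_or sl andbT; case: ifP => // iD'.
    by rewrite inE sinj; lia.
  by case: ifP => //= i0; rewrite ul sl.
have := xeig (spine i); rewrite (nbsum_seq ul') => [|u].
  by rewrite E /exact_load (Xs i iD) /= !mulrDr hk.
rewrite /l' !mem_cat; case: u => [[a|j]|c].
- have [-> aD] := spineP a; rewrite adj_spine // (negbTE (sl a)) orbF.
  have e1 : (spine a \in (if (0 < i)%N then [:: spine i.-1] else [::])) = (i == a.+1).
    by case: ifP => i0; rewrite ?in_nil ?inE ?sinj; lia.
  have e2 : (spine a \in (if (i < D)%N then [:: spine i.+1] else [::])) = (a == i.+1 :> nat).
    by case: ifP => i0; rewrite ?in_nil ?inE ?sinj; lia.
  by rewrite e1 e2 orbC.
- rewrite -[inl (inr j)]/(leg j) adj_spine_leg // lP eq_sym.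
  by case: ifP => _; case: ifP => _; rewrite ?in_nil ?inE.
- rewrite -[inr c]/(toe c) adj_spine_toe.
  have -> : (toe c \in l) = false by apply/negP => /ll[].
  by case: ifP => _; case: ifP => _; rewrite ?in_nil ?inE.
Qed.

Lemma spine_exact : [/\ exact_load t s (kappa2 s) X 3,
  exact_load t s (kappa1 s) X (k1 + 4), exact_load t s (kappa2 s) X (D.+1 - 2) &
  forall i, (0 < i <= D.+1)%N -> i <> 3%N -> i <> (k1 + 4)%N -> i <> (D.+1 - 2)%N ->
    exact_load t s 0 X i].
Proof.
have [p0 p1 p2] := leg_pos.
have D6 : (k1 + 6 <= D)%N by rewrite /D; lia.
have Pinj i j : (P j == P i) = (leg j \in [:: leg i]).
  rewrite inE; apply/eqP/eqP => [|[->] //] e; congr leg; move: e.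
  by case: (leg_posP i) => ->; case: (leg_posP j) => ->; rewrite ?p0 ?p1 ?p2 //; lia.
have one i k : t * x (leg i) = k * x (spine (P i)) -> exact_load t s k X (P i).+1.
  move=> h; apply: (spine_exact_load (l := [:: leg i])) => //.
  - by case: (leg_posP i) => ->; rewrite ?p0 ?p1 ?p2; lia.
  - by move=> u; rewrite inE => /eqP ->; exists i.
  - by rewrite big_seq1.
split.
- by have := one _ _ (leg_end_weight false); rewrite /toe_leg p0.
- have -> : (k1 + 4 = (k1 + 3).+1)%N by lia.
  by rewrite -p1; apply: one; rewrite p1; exact: leg1_weight.
- have := one _ _ (leg_end_weight true); rewrite /toe_leg p2.
  by have -> : (D.+1 - 2 = (D - 2).+1)%N by lia.
move=> i iD i3 ih iD2; have -> : i = i.-1.+1 by lia.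
apply: (spine_exact_load (l := [::])) => //; first by lia.
- move=> j; rewrite in_nil; apply/esym/eqP.
  by case: (leg_posP j) => ->; rewrite ?p0 ?p1 ?p2; lia.
- by rewrite big_nil mulr0 mul0r.
Qed.

End Eigenvector.
End TwoGapTree.

(** * Minimizers *)

Section Minimizers.
Local Open Scope ring_scope.
Variables (R : realType) (k1 k2 : nat).
Let T := tree_T [:: k1; k2].
Let D := (k1 + k2 + 6)%N.
Let rho := spectral_radius R T.

Lemma tree_card_gt0 : (0 < #|T|)%N.
Proof. by rewrite card_tree addnC. Qed.

(** Stated for every [t] admitting a positive supersolution on the tree: [tree_parameter] uses it
    for a trial value as well as for the true one. *)
Lemma tree_mu_gt0 (x : T -> R) (t s : R) : 1 < t -> t * t = s -> (forall u, 0 < x u) ->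
  (forall u, t * nbsum x u <= (s + 1) * x u) -> 0 < mu s.
Proof.
move=> t1 tts x0 xs.
have [p0 p1 p2] := leg_pos k1 k2; have gs := spine_geodesic k1 k2.
have Xs := path_supersolution t1 tts x0 xs gs.
have leg_adj (i : 'I_3) : adj (spine k1 k2 (branch_pos [:: k1; k2] i)) (leg k1 k2 i).
  by rewrite adj_spine_leg ?eqxx //; case: (leg_posP i) => ->; rewrite ?p0 ?p1 ?p2; lia.
have h2 b : load t (kappa2 s) (path_values D x (spine k1 k2))
    (branch_pos [:: k1; k2] (toe_leg b)).+1.
  have bD : (branch_pos [:: k1; k2] (toe_leg b) <= k1 + k2 + 6)%N.
    by case: b; rewrite /toe_leg ?p0 ?p2; lia.
  have lt : adj (leg k1 k2 (toe_leg b)) (toe k1 k2 b) by rewrite adj_leg_toe.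
  exact: (heavy_load t1 tts x0 xs gs bD (leg_outer _ _ _) (leg_adj _) lt).
apply: (heavy_ends_mu_gt0 t1 tts Xs (h := (k1 + 4)%N)).
- by lia.
- by lia.
- by have := h2 false; rewrite /toe_leg p0.
- have -> : (k1 + 4 = (k1 + 3).+1)%N by lia.
  rewrite -p1; apply: (hot_load_path t1 tts x0 xs gs); first by rewrite p1; lia.
  by apply: (hotI (leg_outer k1 k2 (inord 1))); exact: leg_adj.
- have := h2 true; rewrite /toe_leg p2.
  by have -> : ((k1 + k2 + 6).+1 - 2 = (k1 + k2 + 6 - 2).+1)%N by lia.
Qed.

(** Writing [rho] as [t + 1 / t] with [t > 1] requires [rho > 2]. Otherwise the Perron vector would
    be a supersolution for some [t > 1] with negative [mu]. *)
Lemma tree_parameter : exists t, [/\ 1 < t, t * rho = t * t + 1 & 0 < mu (t * t)].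
Proof.
have [x [x0 xE]] := perron R (@tree_connected k1 k2) tree_card_gt0.
have rho2 : 2 < rho.
  rewrite ltNge; apply/negP => r2.
  (* Any [t > 1] with [mu (t * t) <= 0] would do. *)
  have t1 : 1 < 5 / 4 :> R by lra.
  have : 0 < mu (5 / 4 * (5 / 4) : R).
    apply: (tree_mu_gt0 t1 erefl x0) => u; rewrite xE -/T -/rho.
    have := ler_wpM2r (ltW (x0 u)) r2; have := x0 u; lra.
  by rewrite /mu; lra.
pose d := Num.sqrt (rho ^+ 2 - 4).
have d2 : d ^+ 2 = rho ^+ 2 - 4 by rewrite sqr_sqrtr //; nra.
have d0 : 0 <= d by exact: sqrtr_ge0.
(* The larger root of t^2 - rho t + 1. *)
exists ((rho + d) / 2).
have t1 : 1 < (rho + d) / 2 by lra.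
have e : (rho + d) / 2 * rho = (rho + d) / 2 * ((rho + d) / 2) + 1.
  have -> : (rho + d) / 2 * ((rho + d) / 2) = (rho ^+ 2 + 2 * rho * d + d ^+ 2) / 4 by field.
  by rewrite d2; field.
split=> //; apply: (tree_mu_gt0 t1 erefl x0) => u.
by rewrite xE -/T -/rho mulrA e.
Qed.

Ltac nlia := graph_lia R.

Hypotheses (k12 : (k1 <= k2 <= k1.+1)%N) (k40 : (40 <= k1)%N).

(** The tree satisfies the relation between the gaps and [mu] with equality, the competitor with an
    inequality at the same [s]. Comparing them by [balanced_sum] leaves only the gaps of the tree,
    up to reversal. *)
Lemma tree_minimal_iso (G : sgraph) : in_class (D + 6) D G ->
  spectral_radius R G <= rho -> isomorphic (tree_T [:: k1; k2]) G.
Proof.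
move=> [cardG cG dG] Gle.
have [t [t1 trho m0]] := tree_parameter.
have [s tts] : exists s, t * t = s by exists (t * t).
rewrite tts in trho m0; have s1 : 1 < s by rewrite -tts; nra.
have t0 : 0 < t by lra.
have eqT : mu s / (s ^+ 2 - 1) =
    1 / (1 + omega s * s ^+ k1.+1) + 1 / (1 + omega s * s ^+ k2.+1).
  have [x [x0 xE]] := perron R (@tree_connected k1 k2) tree_card_gt0.
  have xE' u : t * nbsum x u = (s + 1) * x u by rewrite xE mulrA trho.
  have [e3 eh eD ex] := spine_exact t1 tts xE'.
  have gs := spine_geodesic k1 k2.
  have xs u : t * nbsum x u <= (s + 1) * x u by rewrite xE'.
  have Xs := path_supersolution t1 tts x0 xs gs.
  have [X0 XM Xp _] := Xs.
  have := exact_heavy_ends t1 tts (ltac:(nlia) : (3 < k1 + 4)%N)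
    (ltac:(nlia) : (k1 + 4 < (k1 + k2 + 6).+1 - 2)%N) X0 XM
    (Xp (k1 + 4)%N (ltac:(nlia))) m0 ex e3 eh eD.
  have -> : (k1 + 4 - 3 = k1.+1)%N by nlia.
  by have -> : ((k1 + k2 + 6).+1 - 2 - (k1 + 4) = k2.+1)%N by nlia.
have mb := mu_bound s1 m0 (ltac:(nlia) : (k1.+1 <= k2.+1)%N) eqT.
have m1 : mu s <= 1 / 1000 by exact: (mu_small s1 m0 (ltac:(nlia) : (40 <= k1.+1)%N) mb).
have mB : 0 < mu s <= 1 / 1000 by rewrite m0.
have no4 := mu_too_small s1 mB (ltac:(rewrite /D; nlia) : (D - 2 <= 2 * k1.+1 + 4)%N) mb.
have G0 : (0 < #|G|)%N by rewrite cardG addnC.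
have [x [x0 xE]] := perron R cG G0.
(* The parameter is that of the tree: the smaller spectral radius of [G] makes its Perron vector a
   supersolution. *)
have xs u : t * nbsum x u <= (s + 1) * x u.
  by rewrite xE mulrA ler_pM2r // -trho ler_pM2l.
have D60 : (60 <= D)%N by rewrite /D; nlia.
have diam : forall a b : G, exists2 l, (l <= D)%N & has_walk a b l.
  by have [_] := (diameterP D cG G0).1 dG.
have [v gv] := diameter_geodesic cG G0 dG.
have out5 (w : nat -> G) : geodesic D w -> #|outer D w| = 5%N.
  by move=> gw; have := card_outer gw; rewrite cardG; nlia.
have outer5 := out5 v gv.
have [h [hD hh hl hr _]] := three_hot t1 tts x0 xs mB D60 diam gv outer5 no4.
have Xs := path_supersolution t1 tts x0 xs gv.
have heavyE i : (i <= D)%N -> heavy D v i -> load t (kappa2 s) (path_values D x v) i.+1.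
  move=> iD /existsP[u /secondP[w [ow vw wu ui]]].
  exact: (heavy_load t1 tts x0 xs gv iD ow vw wu ui).
have l3 := heavyE 2%N (ltac:(nlia)) hl; have lD := heavyE (D - 2)%N (ltac:(nlia)) hr.
have eD : ((D - 2).+1 = D.+1 - 2)%N by nlia.
rewrite eD in lD.
have lh := hot_load_path t1 tts x0 xs gv (ltac:(nlia) : (h <= D)%N) hh.
have := heavy_ends_hot_middle t1 tts Xs mB (ltac:(nlia) : (3 < h.+1)%N)
  (ltac:(nlia) : (h.+1 < D.+1 - 2)%N) l3 lh lD.
rewrite eqT => le.
have w0 : 0 < omega s by case/andP: (omega_le t1 tts mB).
have lt1 : 1 / (1 + omega s * s ^+ k1.+1) + 1 / (1 + omega s * s ^+ k2.+1) < 1.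
  by rewrite -eqT ltr_pdivrMr /mu; nra.
have := balanced_sum s1 w0 _ _ lt1 le.
have -> : (h.+1 - 3 + (D.+1 - 2 - h.+1) = k1.+1 + k2.+1)%N by rewrite /D in hD *; nlia.
move=> /(_ erefl (ltac:(nlia)))[[e1 e2]|[e1 e2]].
  have hE : h = (k1 + 3)%N by nlia.
  exact: (tree_isomorphic t1 tts x0 xs mB D60 diam gv outer5 hE erefl hh hl hr).
(* The gaps occur in the opposite order, so the geodesic is read backwards. *)
have gr := geodesic_rev gv; have outer5r := out5 _ gr.
have hE : (D - h = k1 + 3)%N by rewrite /D in hD e2 *; nlia.
apply: (tree_isomorphic t1 tts x0 xs mB D60 diam gr outer5r hE erefl).
- by rewrite hot_rev //; nlia.
- by rewrite -[2%N](subKn (_ : 2 <= D)%N) ?heavy_rev //; nlia.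
- by rewrite heavy_rev //; nlia.
Qed.

(** A graph of smaller spectral radius would be isomorphic to the tree and hence have the same
    one. *)
Lemma tree_is_Gmin : is_Gmin R (D + 6) D T.
Proof.
split=> [|H cH]; first exact: tree_in_class.
rewrite leNgt; apply/negP => lt.
have := isomorphic_spectral_radius R (@tree_connected k1 k2) tree_card_gt0
  (tree_minimal_iso cH (ltW lt)).
by move=> e; move: lt; rewrite -e ltxx.
Qed.

Lemma is_Gmin_iso (G : sgraph) : is_Gmin R (D + 6) D G <-> isomorphic G T.
Proof.
split=> [[cG Gmin]|iso].
  by apply: isomorphic_sym; apply: tree_minimal_iso => //; apply: Gmin; exact: tree_in_class.
have iso' := isomorphic_sym iso.
split=> [|H cH].
  by apply: isomorphic_in_class iso' (tree_in_class k1 k2); rewrite addnC.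
rewrite -(isomorphic_spectral_radius R (@tree_connected k1 k2) tree_card_gt0 iso').
exact: tree_is_Gmin.2.
Qed.

End Minimizers.

Theorem theorem1p2 (R : realType) :
  exists N : nat, forall n : nat, N <= n ->
    [/\ exists G : sgraph, is_Gmin R n (n - 6) G /\
          forall H : sgraph, is_Gmin R n (n - 6) H -> isomorphic H G,
        forall k : nat, n = 2 * k + 12 ->
          forall G : sgraph,
            is_Gmin R n (n - 6) G <-> isomorphic G (tree_T [:: k; k])
      & forall k : nat, n = 2 * k + 13 ->
          forall G : sgraph,
            is_Gmin R n (n - 6) G <-> isomorphic G (tree_T [:: k; k.+1])].
Proof.
(* This makes [k] at least 40 in both parities, as needed for the bound on [mu]. *)
exists 100 => n n100.
have even k : n = 2 * k + 12 -> forall G : sgraph,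
    is_Gmin R n (n - 6) G <-> isomorphic G (tree_T [:: k; k]).
  move=> nE G; have -> : n = k + k + 6 + 6 by lia.
  by rewrite addnK; apply: is_Gmin_iso; lia.
have odd k : n = 2 * k + 13 -> forall G : sgraph,
    is_Gmin R n (n - 6) G <-> isomorphic G (tree_T [:: k; k.+1]).
  move=> nE G; have -> : n = k + k.+1 + 6 + 6 by lia.
  by rewrite addnK; apply: is_Gmin_iso; lia.
split=> //.
have refl (G : sgraph) : isomorphic G G by exists id; split=> //; exists id.
have [k [nE|nE]] : exists k, n = 2 * k + 12 \/ n = 2 * k + 13.
  by exists ((n - 12) %/ 2); lia.
  exists (tree_T [:: k; k]); split; first exact/(even k nE)/refl.
  by move=> H /(even _ nE).
exists (tree_T [:: k; k.+1]); split; first exact/(odd k nE)/refl.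
by move=> H /(odd _ nE).
Qed.
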